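(* Let $n\ge0$ be an integer and let $z\in\mathbb{C}$ with $|z|\le1$. Then $$\sum_{k=1}^{\infty}\binom{2k}{k}\frac{1}{2k+2n+1}\Bigl(\frac z4\Bigr)^k=\frac{1}{4^{n}z^{n+1/2}}\Biggl[\binom{2n}{n}\arcsin\sqrt z+(-1)^n\sum_{\substack{0\le k\le2n\\k\ne n}}(-1)^k\binom{2n}{k}\frac{\sin[2(n-k)\arcsin\sqrt z]}{2(n-k)}\Biggr]-\frac{1}{1+2n}$$ and $$\sum_{k=1}^{\infty}\binom{2k}{k}\frac{1}{1+k+n}\Bigl(\frac z4\Bigr)^k=\frac{(-1)^{1+n}}{4^{n}z^{1+n}}\sum_{k=0}^{1+2n}(-1)^k\binom{1+2n}{k}\frac{\cos[(2n-2k+1)\arcsin\sqrt z]-1}{2n-2k+1}-\frac{1}{1+n}.$$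
   Context: Square root, $\arcsin$ and non-integer powers are principal branches, so $z^{n+1/2}=(\sqrt z)^{2n+1}$. At $z=0$ the right-hand sides are understood as their limits as $z\to0$ (removable singularities). Empty sums are $0$. *)

(* Defs.v *)
From Stdlib Require Export Reals.
From Coquelicot Require Export Coquelicot.

Open Scope R_scope.
Open Scope C_scope.

Definition Cexp (z : C) : C :=
  RtoC (exp (Re z)) * (cos (Im z), sin (Im z)).

Definition Csin (z : C) : C := (Cexp (Ci * z) - Cexp (- (Ci * z))) / (RtoC 2 * Ci).

Definition Ccos (z : C) : C := (Cexp (Ci * z) + Cexp (- (Ci * z))) / RtoC 2.

(* Principal argument, in (-PI, PI], for z <> 0; negative reals get PI. *)
Definition Carg (z : C) : R :=
  if Rlt_dec (Im z) 0
  then Ropp (acos (Re z / Cmod z))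
  else acos (Re z / Cmod z).

(* Principal logarithm, for z <> 0. *)
Definition Clog (z : C) : C := (ln (Cmod z), Carg z).

(* Principal power.  The value 0 at z = 0 is the right one for Re a > 0,
   the only case in which it is used: [Csqrt 0] occurs in [Carcsin 1]. *)
Definition Cpower (z a : C) : C :=
  if Ceq_dec z (RtoC 0) then RtoC 0 else Cexp (a * Clog z).

Definition Csqrt (z : C) : C := Cpower z (RtoC (1 / 2)).

(* Principal arcsine; i w + sqrt (1 - w^2) never vanishes. *)
Definition Carcsin (w : C) : C :=
  - Ci * Clog (Ci * w + Csqrt (RtoC 1 - w ^ 2)).

(* v is the value at z of f extended to 0 by its limit there (over w <> 0);
   the limit is required to exist when z = 0. *)
Definition is_value_lim0 (f : C -> C) (z v : C) : Prop :=
  (z <> RtoC 0 -> v = f z) /\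
  (z = RtoC 0 ->
   filterlim (T := C_UniformSpace) (U := C_UniformSpace) f
     (locally' (T := C_UniformSpace) (RtoC 0))
     (locally (T := C_UniformSpace) v)).

(* The sum over k >= 1 of a k converges to s. *)
Definition is_series_from1 (a : nat -> C) (s : C) : Prop :=
  is_series (V := C_NormedModule) (fun k : nat => a (S k)) s.

(* The sum of f k over 0 <= k <= m. *)
Definition Csum (f : nat -> C) (m : nat) : C := sum_n (G := C_AbelianMonoid) f m.

(* Stdlib's binomial coefficient [Binomial.C] is hidden by the type [C]. *)
Notation binom := Binomial.C.

(* Main.v *)
(* Put [w = sqrt z] and let [b k = binom (2 k) k / 4 ^ k].  Both series are, up to
   a factor, [F_m(z) = sum_k b k / (2 k + m + 1) z ^ k] with [m = 2 n] or
   [m = 2 n + 1], and [w ^ (m + 1) F_m(w ^ 2)] is the primitive of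
   [w ^ m / sqrt (1 - w ^ 2)], i.e. of [sin ^ m] in the variable [t = arcsin w];
   the right-hand sides are the Fourier expansions of that primitive.

   Complex analysis is avoided by working along the ray [r w], [0 <= r < 1], with
   curves from R to C.  The series [A] of arcsin satisfies
   [exp (+- i A(r)) = +- i r w + sqrt (1 - r ^ 2 w ^ 2)] because both sides solve
   the same linear differential equation, so [sin A(r) = r w].  Absolute
   convergence lets [r] tend to 1.  As the coefficients of [A] are nonnegative
   with sum at most [arcsin 1 = PI / 2], [|A| <= PI / 2], and this identifies [A]
   with the principal arcsine.  The same bound on the coefficients gives the limit
   at [z = 0]. *)

From Stdlib Require Import Lra Lia Psatz.
Require Import Defs.

(** * Complex exponential, sine and principal arcsine *)

Lemma Cexp_0 : Cexp 0 = 1.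
Proof.
  unfold Cexp; simpl; rewrite exp_0, cos_0, sin_0.
  apply injective_projections; simpl; ring.
Qed.

Lemma Cexp_plus (a b : C) : Cexp (a + b) = Cexp a * Cexp b.
Proof.
  unfold Cexp, Re, Im; apply injective_projections; simpl;
    rewrite exp_plus, ?cos_plus, ?sin_plus; ring.
Qed.

Lemma Cexp_opp_l (a : C) : Cexp (- a) * Cexp a = 1.
Proof. rewrite <- Cexp_plus, <- Cexp_0; f_equal; ring. Qed.

Lemma Cexp_pow (a : C) (k : nat) : Cexp a ^ k = Cexp (RtoC (INR k) * a).
Proof.
  induction k as [|k IH].
  - simpl; rewrite Cmult_0_l, Cexp_0; reflexivity.
  - rewrite Cpow_S, IH, <- Cexp_plus; f_equal.
    rewrite S_INR, RtoC_plus; ring.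
Qed.

Lemma Cmod_Cexp (a : C) : Cmod (Cexp a) = exp (Re a).
Proof.
  unfold Cexp; rewrite Cmod_mult, Cmod_R, Rabs_pos_eq by (left; apply exp_pos).
  enough (H1 : Cmod (cos (Im a), sin (Im a)) = 1%R) by (rewrite H1; apply Rmult_1_r).
  pose proof (sin2_cos2 (Im a)) as H; unfold Rsqr in H.
  apply eq_trans with (sqrt 1); [|apply sqrt_1].
  unfold Cmod; f_equal; simpl; lra.
Qed.

Lemma Csin_0 : Csin 0 = 0.
Proof.
  unfold Csin; rewrite Cmult_0_r; replace (- 0) with (RtoC 0) by ring.
  unfold Cminus, Cdiv; rewrite Cplus_opp_r; ring.
Qed.

Lemma Ci_nz : Ci <> 0.
Proof. intros H; apply (f_equal snd) in H; simpl in H; lra. Qed.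

Lemma Ci_sqr : Ci * Ci = - RtoC 1.
Proof. apply injective_projections; simpl; ring. Qed.

Lemma RtoC_nz (x : R) : x <> 0%R -> RtoC x <> 0.
Proof. intros H E; apply H; now apply RtoC_inj. Qed.

(** Keeps [Ci] out of the denominator: [ring] and [field] do not know that [Ci * Ci = - 1], so this
    relation is applied separately through [Ci_sqr]. *)
Lemma Csin_alt (t : C) :
  Csin t = - Ci * ((Cexp (Ci * t) - Cexp (- (Ci * t))) / RtoC 2).
Proof.
  unfold Csin; set (d := _ - _).
  replace (- Ci * (d / RtoC 2)) with (- (Ci * Ci) * (d / (RtoC 2 * Ci))).
  - rewrite Ci_sqr; ring.
  - field; apply Ci_nz.
Qed.

Lemma Csin_Ccos_sqr (t : C) : Csin t ^ 2 + Ccos t ^ 2 = 1.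
Proof.
  rewrite Csin_alt; unfold Ccos.
  pose proof (Cexp_opp_l (Ci * t)) as E.
  set (x := Cexp (Ci * t)) in *; set (y := Cexp (- (Ci * t))) in *.
  transitivity (Ci * Ci * ((x - y) / RtoC 2) ^ 2 + ((x + y) / RtoC 2) ^ 2);
    [ring|].
  transitivity (y * x); [rewrite Ci_sqr; field | exact E].
Qed.

Lemma Cexp_i_sin_cos (t : C) : Cexp (Ci * t) = Ci * Csin t + Ccos t.
Proof.
  unfold Csin, Ccos; field; apply Ci_nz.
Qed.

Lemma Clog_Cexp (u : C) : - PI < Im u <= PI -> Clog (Cexp u) = u.
Proof.
  intros [H1 H2]; pose proof (exp_pos (Re u)) as Hp.
  unfold Clog, Carg; rewrite Cmod_Cexp, ln_exp.
  assert (HR : Re (Cexp u) = (exp (Re u) * cos (Im u))%R)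
    by (unfold Cexp; simpl; ring).
  assert (HI : Im (Cexp u) = (exp (Re u) * sin (Im u))%R)
    by (unfold Cexp; simpl; ring).
  rewrite HR, HI.
  replace (exp (Re u) * cos (Im u) / exp (Re u))%R with (cos (Im u))
    by (field; lra).
  apply injective_projections; simpl; [reflexivity|].
  change (snd u) with (Im u).
  (* On the interval from [-PI] (excluded) to [PI] the sine is negative exactly at the negative
     angles, so the two mixed cases are contradictory. *)
  destruct (Rlt_dec _ 0) as [Hs|Hs]; destruct (Rlt_or_le (Im u) 0) as [Hu|Hu].
  - rewrite <- cos_neg, acos_cos; lra.
  - pose proof (sin_ge_0 (Im u) Hu H2); nra.
  - pose proof (sin_lt_0_var (Im u) H1 Hu); apply Rnot_lt_le in Hs; nra.
  - apply acos_cos; lra.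
Qed.

Lemma Cmod_sqr (c : C) : (Cmod c * Cmod c = Re c * Re c + Im c * Im c)%R.
Proof. unfold Cmod; rewrite sqrt_sqrt; [unfold Re, Im; ring | nra]. Qed.

(** With [x], [y] the coordinates of [c] divided by its modulus,
    [sin (acos x) = sqrt (1 - x ^ 2) = |y|], and the case distinction in [Carg] restores the sign of
    [y]. *)
Lemma Carg_bound (c : C) : c <> 0 ->
  - PI < Carg c <= PI /\ cos (Carg c) = (Re c / Cmod c)%R /\
  sin (Carg c) = (Im c / Cmod c)%R.
Proof.
  intros Hc; pose proof (Cmod_gt_0 c) as [Hm _]; specialize (Hm Hc).
  pose proof (Cmod_sqr c) as E; unfold Carg.
  set (x := (Re c / Cmod c)%R); set (y := (Im c / Cmod c)%R).
  assert (HI : Im c = (y * Cmod c)%R) by (unfold y; field; lra).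
  assert (HR : Re c = (x * Cmod c)%R) by (unfold x; field; lra).
  assert (Exy : (x * x + y * y = 1)%R).
  { apply Rmult_eq_reg_r with (Cmod c * Cmod c)%R; [|nra].
    rewrite HI, HR in E; lra. }
  assert (Hx : -1 <= x <= 1) by nra.
  pose proof (acos_bound x) as Hb; pose proof PI_RGT_0.
  pose proof (cos_acos x Hx) as Hcos; pose proof (sin_acos x Hx) as Hsin.
  replace (1 - x²)%R with (y²) in Hsin by (unfold Rsqr; lra).
  rewrite sqrt_Rsqr_abs in Hsin.
  destruct (Rlt_dec (Im c) 0) as [Hi|Hi].
  - assert (Hy : y < 0) by nra.
    rewrite cos_neg, sin_neg, Hsin, Rabs_left by trivial.
    repeat split; trivial; try lra.
    (* The value [-PI] is excluded: it would give [x = -1], hence [y = 0], against [y < 0]. *)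
    destruct (Req_dec (acos x) PI) as [Ep|]; [|lra].
    rewrite Ep, cos_PI in Hcos; nra.
  - assert (Hy : 0 <= y) by nra.
    rewrite Hsin, Rabs_pos_eq by trivial; repeat split; trivial; lra.
Qed.

Lemma Cexp_Clog (c : C) : c <> 0 -> Cexp (Clog c) = c.
Proof.
  intros Hc; destruct (Carg_bound c Hc) as [_ [H1 H2]].
  pose proof (Cmod_gt_0 c) as [Hm _]; specialize (Hm Hc).
  unfold Cexp, Clog; simpl; rewrite H1, H2, exp_ln by trivial.
  apply injective_projections; simpl; unfold Re, Im; field; lra.
Qed.

Lemma Csqrt_sqr (z : C) : Csqrt z * Csqrt z = z.
Proof.
  unfold Csqrt, Cpower; destruct (Ceq_dec z 0) as [->|Hz]; [ring|].
  transitivity (Cexp (Clog z)); [rewrite <- Cexp_plus; f_equal | now apply Cexp_Clog].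
  rewrite <- Cmult_plus_distr_r, <- RtoC_plus.
  replace (1 / 2 + 1 / 2)%R with 1%R by field; ring.
Qed.

(** In the right half-plane the argument lies strictly between [-PI/2] and [PI/2], so twice the
    logarithm of [c] is still a principal logarithm. The case [c = 0] rests on the value that
    [Cpower] takes at 0. *)
Lemma Csqrt_of_sqr (c : C) : 0 < Re c \/ c = 0 -> Csqrt (c * c) = c.
Proof.
  intros [Hr| ->]; unfold Csqrt, Cpower.
  - assert (Hc : c <> 0) by (intros ->; simpl in Hr; lra).
    destruct (Ceq_dec (c * c) 0) as [E|_]; [now apply Cmult_neq_0 in E|].
    destruct (Carg_bound c Hc) as [Hb [Hcos _]].
    assert (0 < cos (Carg c)).
    { rewrite Hcos; apply Rdiv_lt_0_compat; trivial; now apply Cmod_gt_0. }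
    assert (- (PI / 2) < Carg c < PI / 2).
    { split; apply Rnot_le_lt; intros Hn.
      - pose proof (cos_le_0 (- Carg c)) as Q; rewrite cos_neg in Q; lra.
      - pose proof (cos_le_0 (Carg c)); lra. }
    transitivity (Cexp (Clog c)); [|now apply Cexp_Clog].
    replace (Clog (c * c)) with (Clog c + Clog c).
    + f_equal; replace (RtoC (1 / 2)) with (RtoC 1 / RtoC 2)
        by (rewrite <- RtoC_div; trivial; lra).
      field.
    + rewrite <- (Clog_Cexp (Clog c + Clog c)) by (simpl; lra).
      rewrite Cexp_plus, Cexp_Clog by trivial; reflexivity.
  - destruct (Ceq_dec (0 * 0) 0) as [_|E]; [reflexivity|].
    exfalso; apply E; ring.
Qed.

Lemma Ccos_Re (t : C) :
  Re (Ccos t) = ((exp (Im t) + exp (- Im t)) / 2 * cos (Re t))%R.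
Proof.
  unfold Ccos, Cexp, Re, Im; simpl.
  replace (0 * fst t - 1 * snd t)%R with (- snd t)%R by ring.
  replace (0 * snd t + 1 * fst t)%R with (fst t) by ring.
  rewrite cos_neg, sin_neg, Ropp_involutive; field.
Qed.

Lemma Ccos_Im (t : C) :
  Im (Ccos t) = ((exp (- Im t) - exp (Im t)) / 2 * sin (Re t))%R.
Proof.
  unfold Ccos, Cexp, Re, Im; simpl.
  replace (0 * fst t - 1 * snd t)%R with (- snd t)%R by ring.
  replace (0 * snd t + 1 * fst t)%R with (fst t) by ring.
  rewrite cos_neg, sin_neg, Ropp_involutive; field.
Qed.

Lemma Ccos_eq0 (t : C) : cos (Re t) = 0%R -> Im t = 0%R -> Ccos t = 0.
Proof.
  intros H1 H2; apply injective_projections.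
  - change (Re (Ccos t) = 0%R); rewrite Ccos_Re, H1; ring.
  - change (Im (Ccos t) = 0%R); rewrite Ccos_Im, H2, Ropp_0; unfold Rdiv; ring.
Qed.

(* The hypothesis on [Cmod t] forces [Re t] into [-PI/2, PI/2], the endpoints
   being attained only at [t = -PI/2, PI/2], where the cosine vanishes. *)
Lemma Carcsin_Csin (t : C) : Cmod t <= PI / 2 -> Carcsin (Csin t) = t.
Proof.
  intros Ht; pose proof PI_RGT_0 as Hpi.
  pose proof (Cmod_sqr t) as Em; pose proof (Cmod_ge_0 t).
  assert (Hx : - (PI / 2) <= Re t <= PI / 2) by nra.
  assert (Hc : 0 < Re (Ccos t) \/ Ccos t = 0).
  { destruct (Rtotal_order (Re t) (PI / 2)) as [H1|[H1|H1]]; [|right|lra].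
    - destruct (Rtotal_order (Re t) (- (PI / 2))) as [H2|[H2|H2]]; [lra|right|left].
      + assert (Im t = 0%R) by nra.
        apply Ccos_eq0; trivial; rewrite H2, cos_neg; apply cos_PI2.
      + rewrite Ccos_Re; apply Rmult_lt_0_compat; [|apply cos_gt_0; lra].
        pose proof (exp_pos (Im t)); pose proof (exp_pos (- Im t)); lra.
    - assert (Im t = 0%R) by nra.
      apply Ccos_eq0; trivial; rewrite H1; apply cos_PI2. }
  unfold Carcsin.
  replace (RtoC 1 - Csin t ^ 2) with (Ccos t * Ccos t)
    by (rewrite <- (Csin_Ccos_sqr t); ring).
  rewrite Csqrt_of_sqr, <- Cexp_i_sin_cos, Clog_Cexp
    by (trivial || (simpl; unfold Re, Im in *; lra)).
  transitivity (- (Ci * Ci) * t); [ring | rewrite Ci_sqr; ring].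
Qed.

(** * Differentiable curves and limits in C *)

(** Differentiability is taken coordinatewise in a real parameter, so that the real rules and the
    real constancy criterion apply to each coordinate. *)
Definition cderiv (f : R -> C) (s : R) (l : C) : Prop :=
  is_derive (fun r => Re (f r)) s (Re l) /\
  is_derive (fun r => Im (f r)) s (Im l).

Definition clim (u : nat -> C) (l : C) : Prop :=
  is_lim_seq (fun j => Re (u j)) (Re l) /\
  is_lim_seq (fun j => Im (u j)) (Im l).

Lemma is_derive_val (f : R -> R) (s l l' : R) :
  is_derive f s l -> l = l' -> is_derive f s l'.
Proof. now intros H <-. Qed.

Lemma cderiv_val (f : R -> C) (s : R) (l l' : C) :
  cderiv f s l -> l = l' -> cderiv f s l'.
Proof. now intros H <-. Qed.

Lemma cderiv_ext (f g : R -> C) (s : R) (l : C) :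
  (forall r, f r = g r) -> cderiv f s l -> cderiv g s l.
Proof.
  intros E [H1 H2]; split;
    [eapply is_derive_ext; [|exact H1] | eapply is_derive_ext; [|exact H2]];
    intros r; simpl; now rewrite E.
Qed.

Lemma is_derive_Rconst (a s : R) : is_derive (fun _ => a) s 0%R.
Proof. exact (is_derive_const (V := R_NormedModule) a s). Qed.

Lemma is_derive_Rplus (f g : R -> R) (s l m : R) :
  is_derive f s l -> is_derive g s m ->
  is_derive (fun r => f r + g r)%R s (l + m)%R.
Proof. exact (is_derive_plus (V := R_NormedModule) f g s l m). Qed.

Lemma is_derive_Rminus (f g : R -> R) (s l m : R) :
  is_derive f s l -> is_derive g s m ->
  is_derive (fun r => f r - g r)%R s (l - m)%R.
Proof. exact (is_derive_minus (V := R_NormedModule) f g s l m). Qed.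

Lemma is_derive_Rmult (f g : R -> R) (s l m : R) :
  is_derive f s l -> is_derive g s m ->
  is_derive (fun r => f r * g r)%R s (l * g s + f s * m)%R.
Proof. intros H1 H2; exact (is_derive_mult f g s l m H1 H2 Rmult_comm). Qed.

Lemma is_derive_Rcomp (f g : R -> R) (s l m : R) :
  is_derive f (g s) l -> is_derive g s m ->
  is_derive (fun r => f (g r)) s (m * l)%R.
Proof. exact (is_derive_comp (V := R_NormedModule) f g s l m). Qed.

Lemma cderiv_const (c : C) (s : R) : cderiv (fun _ => c) s 0.
Proof. split; exact (is_derive_Rconst _ s). Qed.

Lemma cderiv_real (f : R -> R) (s l : R) :
  is_derive f s l -> cderiv (fun r => RtoC (f r)) s (RtoC l).
Proof. intros H; split; [exact H | exact (is_derive_Rconst 0 s)]. Qed.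

Lemma cderiv_plus (f g : R -> C) (s : R) (l m : C) :
  cderiv f s l -> cderiv g s m -> cderiv (fun r => f r + g r) s (l + m).
Proof. intros [H1 H2] [H3 H4]; split; now apply is_derive_Rplus. Qed.

Lemma cderiv_mult (f g : R -> C) (s : R) (l m : C) :
  cderiv f s l -> cderiv g s m ->
  cderiv (fun r => f r * g r) s (l * g s + f s * m).
Proof.
  intros [H1 H2] [H3 H4]; split; simpl.
  - eapply is_derive_val;
      [apply is_derive_Rminus; apply is_derive_Rmult; eassumption|].
    unfold Re, Im; ring.
  - eapply is_derive_val;
      [apply is_derive_Rplus; apply is_derive_Rmult; eassumption|].
    unfold Re, Im; ring.
Qed.

Lemma cderiv_scal (c : C) (f : R -> C) (s : R) (l : C) :
  cderiv f s l -> cderiv (fun r => c * f r) s (c * l).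
Proof.
  intros H; eapply cderiv_val;
    [apply cderiv_mult; [apply cderiv_const | exact H] | cbv beta; ring].
Qed.

Lemma cderiv_Cexp (f : R -> C) (s : R) (l : C) :
  cderiv f s l -> cderiv (fun r => Cexp (f r)) s (Cexp (f s) * l).
Proof.
  intros [H1 H2].
  apply cderiv_val with
    (RtoC (Re l * exp (Re (f s))) * (cos (Im (f s)), sin (Im (f s))) +
     RtoC (exp (Re (f s))) * (Im l * - sin (Im (f s)), Im l * cos (Im (f s)))%R).
  - apply (cderiv_mult (fun r => RtoC (exp (Re (f r))))
             (fun r => (cos (Im (f r)), sin (Im (f r))))).
    + apply cderiv_real, (is_derive_Rcomp exp); [apply is_derive_exp | exact H1].
    + split; [apply (is_derive_Rcomp cos) | apply (is_derive_Rcomp sin)]; trivial;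
        [apply is_derive_cos | apply is_derive_sin].
  - apply injective_projections; unfold Cexp, Re, Im; simpl; ring.
Qed.

Lemma is_derive_0_const (f : R -> R) (a b : R) :
  (forall s, 0 <= s < b -> is_derive f s 0%R) -> 0 <= a < b -> f a = f 0%R.
Proof.
  intros H [[Ha|<-] Hb]; [|reflexivity].
  symmetry; apply (eq_is_derive (V := R_NormedModule) f); trivial.
  intros t Ht; apply H; lra.
Qed.

(** The tool behind [Beta_sqr], [Arc_exp] and [Phi_eq]: a suitable combination of the two sides has
    zero derivative on the ray and is then evaluated at its origin. *)
Lemma cderiv_0_const (f : R -> C) (a b : R) :
  (forall s, 0 <= s < b -> cderiv f s 0) -> 0 <= a < b -> f a = f 0%R.
Proof.
  intros H Ha; apply injective_projections.
  - apply (is_derive_0_const (fun r => Re (f r)) a b); trivial; intros; now apply H.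
  - apply (is_derive_0_const (fun r => Im (f r)) a b); trivial; intros; now apply H.
Qed.

Lemma clim_const (c : C) : clim (fun _ => c) c.
Proof. split; apply is_lim_seq_const. Qed.

Lemma clim_ext (u v : nat -> C) (l : C) :
  (forall j, u j = v j) -> clim u l -> clim v l.
Proof.
  intros E [H1 H2]; split;
    [eapply is_lim_seq_ext; [|exact H1] | eapply is_lim_seq_ext; [|exact H2]];
    intros r; simpl; now rewrite E.
Qed.

Lemma clim_unique (u : nat -> C) (l m : C) : clim u l -> clim u m -> l = m.
Proof.
  intros [H1 H2] [H3 H4]; apply injective_projections.
  - apply is_lim_seq_unique in H1; apply is_lim_seq_unique in H3.
    rewrite H1 in H3; now injection H3.
  - apply is_lim_seq_unique in H2; apply is_lim_seq_unique in H4.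
    rewrite H2 in H4; now injection H4.
Qed.

Lemma clim_plus (u v : nat -> C) (l m : C) :
  clim u l -> clim v m -> clim (fun j => u j + v j) (l + m).
Proof. intros [H1 H2] [H3 H4]; split; now apply is_lim_seq_plus'. Qed.

Lemma clim_mult (u v : nat -> C) (l m : C) :
  clim u l -> clim v m -> clim (fun j => u j * v j) (l * m).
Proof.
  intros [H1 H2] [H3 H4]; split; simpl.
  - apply is_lim_seq_minus'; now apply is_lim_seq_mult'.
  - apply is_lim_seq_plus'; now apply is_lim_seq_mult'.
Qed.

Lemma clim_real (u : nat -> R) (l : R) :
  is_lim_seq u l -> clim (fun j => RtoC (u j)) (RtoC l).
Proof. intros H; split; [exact H | apply is_lim_seq_const]. Qed.

Lemma clim_pow (u : nat -> C) (l : C) (k : nat) :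
  clim u l -> clim (fun j => u j ^ k) (l ^ k).
Proof.
  intros H; induction k as [|k IH]; simpl; [apply clim_const | now apply clim_mult].
Qed.

Lemma clim_Cexp (u : nat -> C) (l : C) :
  clim u l -> clim (fun j => Cexp (u j)) (Cexp l).
Proof.
  intros [H1 H2]; apply clim_mult.
  - apply clim_real, is_lim_seq_continuous; trivial.
    apply derivable_continuous_pt, derivable_pt_exp.
  - split; simpl; apply is_lim_seq_continuous; trivial;
      [apply continuity_cos | apply continuity_sin].
Qed.

(* A working notion of holomorphy: [H] has derivative [h] along every
   differentiable curve, and is sequentially continuous. *)
Definition hol (H h : C -> C) : Prop :=
  (forall f s l, cderiv f s l -> cderiv (fun r => H (f r)) s (h (f s) * l)) /\
  (forall u l, clim u l -> clim (fun j => H (u j)) (H l)).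

Lemma hol_ext (F G f g : C -> C) :
  (forall t, F t = G t) -> (forall t, f t = g t) -> hol F f -> hol G g.
Proof.
  intros E e [H1 H2]; split.
  - intros u s l Hu; rewrite <- e.
    apply cderiv_ext with (fun r => F (u r)); auto.
  - intros u l Hu; rewrite <- E; apply clim_ext with (fun j => F (u j)); auto.
Qed.

Lemma hol_const (c : C) : hol (fun _ => c) (fun _ => 0).
Proof.
  split; intros; [|apply clim_const].
  eapply cderiv_val; [apply cderiv_const | ring].
Qed.

Lemma hol_id : hol (fun t => t) (fun _ => 1).
Proof.
  split; intros; trivial; eapply cderiv_val; [eassumption | ring].
Qed.

Lemma hol_plus (F f G g : C -> C) :
  hol F f -> hol G g -> hol (fun t => F t + G t) (fun t => f t + g t).
Proof.
  intros [H1 H2] [H3 H4]; split; intros u.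
  - intros s l Hu; eapply cderiv_val.
    + apply (cderiv_plus (fun r => F (u r)) (fun r => G (u r))); eauto.
    + ring.
  - intros l Hu; apply (clim_plus (fun j => F (u j)) (fun j => G (u j))); auto.
Qed.

Lemma hol_scal (c : C) (F f : C -> C) :
  hol F f -> hol (fun t => c * F t) (fun t => c * f t).
Proof.
  intros [H1 H2]; split; intros u.
  - intros s l Hu; eapply cderiv_val.
    + apply (cderiv_scal c (fun r => F (u r))); eauto.
    + ring.
  - intros l Hu; apply (clim_mult (fun _ => c) (fun j => F (u j)));
      [apply clim_const | auto].
Qed.

Lemma hol_Cexp (c : C) : hol (fun t => Cexp (c * t)) (fun t => c * Cexp (c * t)).
Proof.
  split; intros.
  - eapply cderiv_val; [apply cderiv_Cexp, cderiv_scal; eassumption | cbv beta; ring].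
  - apply clim_Cexp, clim_mult; [apply clim_const | trivial].
Qed.

Lemma hol_Csum (F f : nat -> C -> C) (m : nat) :
  (forall k, hol (F k) (f k)) ->
  hol (fun t => Csum (fun k => F k t) m) (fun t => Csum (fun k => f k t) m).
Proof.
  intros H; induction m as [|m IH].
  - apply hol_ext with (F 0%nat) (f 0%nat); trivial;
      intros t; unfold Csum; now rewrite sum_O.
  - eapply hol_ext; [| |exact (hol_plus _ _ _ _ IH (H (S m)))];
      intros t; unfold Csum; now rewrite sum_Sn.
Qed.

Lemma hol_Csin (c : C) : hol (fun t => Csin (c * t)) (fun t => c * Ccos (c * t)).
Proof.
  (* The exponential form is differentiated first; the two goals left over translate the function
     and its derivative back to [Csin] and [Ccos]. *)
  eapply hol_ext; cycle 2.
  - apply hol_scal with (c := - Ci / RtoC 2), hol_plus;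
      [apply (hol_Cexp (Ci * c)) | apply hol_scal with (c := - RtoC 1), (hol_Cexp (- Ci * c))].
  - intros t; simpl; rewrite Csin_alt.
    replace (Ci * (c * t)) with (Ci * c * t) by ring.
    replace (- Ci * c * t) with (- (Ci * c * t)) by ring.
    field.
  - intros t; simpl; unfold Ccos.
    replace (Ci * (c * t)) with (Ci * c * t) by ring.
    replace (- Ci * c * t) with (- (Ci * c * t)) by ring.
    set (x := Cexp (Ci * c * t)); set (y := Cexp (- (Ci * c * t))).
    transitivity (- (Ci * Ci) * c * (x + y) / RtoC 2); [field |].
    rewrite Ci_sqr; field.
Qed.

Lemma hol_Ccos (c : C) : hol (fun t => Ccos (c * t)) (fun t => - c * Csin (c * t)).
Proof.
  eapply hol_ext; cycle 2.
  - apply hol_scal with (c := / RtoC 2), hol_plus;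
      [apply (hol_Cexp (Ci * c)) | apply (hol_Cexp (- Ci * c))].
  - intros t; simpl; unfold Ccos.
    replace (Ci * (c * t)) with (Ci * c * t) by ring.
    replace (- Ci * c * t) with (- (Ci * c * t)) by ring.
    field.
  - intros t; simpl; rewrite Csin_alt.
    replace (Ci * (c * t)) with (Ci * c * t) by ring.
    replace (- Ci * c * t) with (- (Ci * c * t)) by ring.
    field.
Qed.

(** * Finite sums and the binomial theorem in C *)

Lemma Csum_0 (f : nat -> C) : Csum f 0 = f 0%nat.
Proof. exact (sum_O (G := C_AbelianMonoid) f). Qed.

Lemma Csum_S (f : nat -> C) (m : nat) : Csum f (S m) = Csum f m + f (S m).
Proof. exact (sum_Sn (G := C_AbelianMonoid) f m). Qed.

Lemma Csum_ext (f g : nat -> C) (m : nat) :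
  (forall k, (k <= m)%nat -> f k = g k) -> Csum f m = Csum g m.
Proof. exact (sum_n_ext_loc (G := C_AbelianMonoid) f g m). Qed.

Lemma Csum_scal (c : C) (f : nat -> C) (m : nat) :
  Csum (fun k => c * f k) m = c * Csum f m.
Proof.
  induction m as [|m IH]; [now rewrite !Csum_0|]. rewrite !Csum_S, IH; ring.
Qed.

Lemma Csum_plus (f g : nat -> C) (m : nat) :
  Csum (fun k => f k + g k) m = Csum f m + Csum g m.
Proof.
  induction m as [|m IH]; [now rewrite !Csum_0|]. rewrite !Csum_S, IH; ring.
Qed.

Lemma Csum_shift (f : nat -> C) (m : nat) :
  Csum f (S m) = f 0%nat + Csum (fun k => f (S k)) m.
Proof.
  induction m as [|m IH]; [now rewrite Csum_S, !Csum_0|].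
  rewrite Csum_S, IH, Csum_S; ring.
Qed.

(** Serves to put the middle term, left out of the sum in [Heven], back into a full binomial sum. *)
Lemma Csum_delta (c : C) (n m : nat) :
  Csum (fun k => if Nat.eqb k n then c else 0) m = if (n <=? m)%nat then c else 0.
Proof.
  induction m as [|m IH].
  - rewrite Csum_0; now destruct n.
  - rewrite Csum_S, IH.
    destruct (Nat.eqb_spec (S m) n); destruct (Nat.leb_spec n m);
      destruct (Nat.leb_spec n (S m)); lia || ring.
Qed.

Lemma Cbinomial (x y : C) (m : nat) :
  (x + y) ^ m = Csum (fun k => RtoC (binom m k) * y ^ k * x ^ (m - k)) m.
Proof.
  induction m as [|m IH].
  - rewrite Csum_0; simpl; rewrite C_n_0; ring.
  (* Exponent 1 is done apart: Pascal's rule gives only the inner terms of a row, and [Csum] cannot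
     express an empty range of them. *)
  - rewrite Cpow_S, IH; destruct m as [|m].
    { rewrite Csum_S, !Csum_0; simpl; rewrite !C_n_0, C_n_n; ring. }
    set (f := fun k => RtoC (binom (S m) k) * y ^ k * x ^ (S m - k)).
    set (g := fun k => RtoC (binom (S (S m)) k) * y ^ k * x ^ (S (S m) - k)).
    assert (E : Csum (fun k => g (S k)) m = x * Csum (fun k => f (S k)) m + y * Csum f m).
    { rewrite <- !Csum_scal, <- Csum_plus; apply Csum_ext; intros k Hk.
      unfold f, g; rewrite <- pascal, RtoC_plus by lia.
      replace (S (S m) - S k)%nat with (S (m - k)) by lia.
      replace (S m - k)%nat with (S (m - k)) by lia.
      replace (S m - S k)%nat with (m - k)%nat by lia.
      rewrite !Cpow_S; ring. }
    rewrite (Csum_shift g), (Csum_S (fun k => g (S k))), E.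
    transitivity (x * Csum f (S m) + y * Csum f (S m)); [ring|].
    rewrite (Csum_shift f) at 1; rewrite (Csum_S f).
    unfold f, g; rewrite !C_n_0, !C_n_n, !Nat.sub_diag, !Nat.sub_0_r, !Cpow_S.
    simpl; ring.
Qed.

(** * Powers of sine as Fourier sums, and their primitives *)

Lemma RtoC_opp1 : RtoC (-1) = - RtoC 1.
Proof. rewrite <- RtoC_opp; f_equal; ring. Qed.

Lemma Cpow_opp1_sqr (k : nat) : RtoC (-1) ^ k * RtoC (-1) ^ k = 1.
Proof.
  rewrite <- Cpow_mult_l, <- RtoC_mult.
  replace (-1 * -1)%R with 1%R by ring; apply Cpow_1_l.
Qed.

(** In the binomial expansion [m - k] factors [Cexp u] meet [k] factors [Cexp (- u)], whence the
    frequency [m - 2 k]. With [u = i t] this is the Fourier expansion of a power of sine. *)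
Lemma Cexp_diff_pow (u : C) (m : nat) :
  (Cexp u - Cexp (- u)) ^ m =
  Csum (fun k => RtoC (-1) ^ k * RtoC (binom m k) *
                 Cexp (RtoC (INR m - 2 * INR k) * u)) m.
Proof.
  unfold Cminus; rewrite Cbinomial; apply Csum_ext; intros k Hk.
  replace (- Cexp (- u)) with (RtoC (-1) * Cexp (- u))
    by (rewrite RtoC_opp1; ring).
  rewrite Cpow_mult_l, !Cexp_pow.
  replace (RtoC (INR m - 2 * INR k) * u)
    with (RtoC (INR k) * - u + RtoC (INR (m - k)) * u).
  - rewrite Cexp_plus; ring.
  - rewrite minus_INR, !RtoC_minus, RtoC_mult by trivial; ring.
Qed.

(** The sum in the second formula, with [t] for the arcsine. It is the primitive, vanishing at 0, of
    [sin ^ (2 n + 1)] times [- 2 (-1) ^ n 4 ^ n]. *)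
Definition Hodd (n : nat) (t : C) : C :=
  Csum (fun k => RtoC (-1) ^ k * RtoC (binom (1 + 2 * n) k)
                 * ((Ccos (RtoC (2 * INR n - 2 * INR k + 1) * t) - RtoC 1)
                    / RtoC (2 * INR n - 2 * INR k + 1))) (1 + 2 * n).

(** The bracket in the first formula, with [t] for the arcsine. It is the primitive, vanishing at 0,
    of [4 ^ n sin ^ (2 n)]; the linear term comes from frequency 0. *)
Definition Heven (n : nat) (t : C) : C :=
  RtoC (binom (2 * n) n) * t
  + RtoC (-1) ^ n
    * Csum (fun k => if Nat.eqb k n then RtoC 0
                     else RtoC (-1) ^ k * RtoC (binom (2 * n) k)
                          * (Csin (RtoC (2 * (INR n - INR k)) * t)
                             / RtoC (2 * (INR n - INR k)))) (2 * n).

Lemma odd_freq_nz (n k : nat) : (2 * INR n - 2 * INR k + 1)%R <> 0%R.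
Proof.
  rewrite !INR_IZR_INZ, <- !mult_IZR, <- minus_IZR, <- plus_IZR.
  apply not_0_IZR; lia.
Qed.

Lemma Hodd_hol (n : nat) :
  hol (Hodd n)
    (fun t => - (RtoC 2 * RtoC (-1) ^ n * RtoC 4 ^ n) * Csin t ^ (1 + 2 * n)).
Proof.
  unfold Hodd; eapply hol_ext; cycle 2.
  - apply hol_Csum with
      (F := fun k t => RtoC (-1) ^ k * RtoC (binom (1 + 2 * n) k)
                 * ((Ccos (RtoC (2 * INR n - 2 * INR k + 1) * t) - RtoC 1)
                    / RtoC (2 * INR n - 2 * INR k + 1)))
      (f := fun k t => RtoC (-1) ^ k * RtoC (binom (1 + 2 * n) k)
                 * (- Csin (RtoC (2 * INR n - 2 * INR k + 1) * t))).
    intros k; pose proof (RtoC_nz _ (odd_freq_nz n k)) as Hd.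
    set (d := RtoC (2 * INR n - 2 * INR k + 1)) in *.
    apply hol_scal; eapply hol_ext; cycle 2.
    + apply hol_scal with (c := / d), hol_plus; 
      [apply hol_Ccos with (c := d) | apply hol_const with (c := - RtoC 1)].
    + intros t; simpl; field; exact Hd.
    + intros t; simpl; field; exact Hd.
  - reflexivity.
  - intros t.
    set (D := Cexp (Ci * t) - Cexp (- (Ci * t))).
    (* [D] is [2 i sin t]. Expanding the powers of [D] and [- D] termwise pairs the frequencies [d]
       and [- d] into a sine; as the exponent is odd, the two powers reinforce each other. *)
    transitivity (Ci / RtoC 2 * (D ^ (1 + 2 * n) + RtoC (-1) * (- D) ^ (1 + 2 * n))).
    + replace (- D) with (Cexp (- (Ci * t)) - Cexp (- - (Ci * t)))
        by (unfold D; replace (- - (Ci * t)) with (Ci * t) by ring; ring).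
      unfold D; rewrite !Cexp_diff_pow, <- Csum_scal, <- Csum_plus, <- Csum_scal.
      apply Csum_ext; intros k _.
      replace (INR (1 + 2 * n) - 2 * INR k)%R with (2 * INR n - 2 * INR k + 1)%R
        by (rewrite plus_INR, mult_INR; simpl; ring).
      set (d := RtoC (2 * INR n - 2 * INR k + 1)).
      rewrite Csin_alt.
      replace (Ci * (d * t)) with (d * (Ci * t)) by ring.
      replace (- (d * (Ci * t))) with (d * - (Ci * t)) by ring.
      rewrite RtoC_opp1; field.
    + rewrite Csin_alt; fold D.
      rewrite !Cpow_add_r, !Cpow_mult_r, !Cpow_1_r.
      replace ((- D) ^ 2) with (D ^ 2) by ring.
      replace ((- Ci * (D / RtoC 2)) ^ 2) with (RtoC (-1) * (D ^ 2 * / RtoC 4)).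
      * rewrite !Cpow_mult_l, Cpow_inv by (apply RtoC_nz; lra).
        assert (H4 : RtoC 4 ^ n <> 0) by (apply Cpow_nz, RtoC_nz; lra).
        pose proof (Cpow_opp1_sqr n) as E.
        set (a := RtoC (-1) ^ n) in *; set (b := RtoC 4 ^ n) in *.
        set (X := (D ^ 2) ^ n).
        transitivity ((a * a) * (Ci * D * X)); [rewrite E|]; rewrite ?RtoC_opp1; field; trivial.
      * transitivity ((Ci * Ci) * (D ^ 2 * / RtoC 4)); [rewrite Ci_sqr, RtoC_opp1; ring | field].
Qed.

Lemma Heven_hol (n : nat) :
  hol (Heven n) (fun t => RtoC 4 ^ n * Csin t ^ (2 * n)).
Proof.
  unfold Heven; eapply hol_ext; cycle 2.
  - apply hol_plus; [apply hol_scal, hol_id | apply hol_scal].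
    apply hol_Csum with
      (F := fun k t => if Nat.eqb k n then RtoC 0
                     else RtoC (-1) ^ k * RtoC (binom (2 * n) k)
                          * (Csin (RtoC (2 * (INR n - INR k)) * t)
                             / RtoC (2 * (INR n - INR k))))
      (f := fun k t => if Nat.eqb k n then RtoC 0
                     else RtoC (-1) ^ k * RtoC (binom (2 * n) k)
                          * Ccos (RtoC (2 * (INR n - INR k)) * t)).
    intros k; destruct (Nat.eqb_spec k n) as [_|Hk]; [apply hol_const|].
    assert (Hd : RtoC (2 * (INR n - INR k)) <> 0).
    { apply RtoC_nz; intros E; apply Hk, INR_eq; lra. }
    set (d := RtoC (2 * (INR n - INR k))) in *.
    apply hol_scal; eapply hol_ext; cycle 2.
    + apply hol_scal with (c := / d), hol_Csin with (c := d).
    + intros t; simpl; field; exact Hd.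
    + intros t; simpl; field; exact Hd.
  - reflexivity.
  - intros t.
    set (D := Cexp (Ci * t) - Cexp (- (Ci * t))).
    (* The same pairing as in the odd case, now with a plus sign, produces cosines. *)
    transitivity (RtoC (-1) ^ n * (/ RtoC 2 * (D ^ (2 * n) + (- D) ^ (2 * n)))).
    + replace (- D) with (Cexp (- (Ci * t)) - Cexp (- - (Ci * t)))
        by (unfold D; replace (- - (Ci * t)) with (Ci * t) by ring; ring).
      unfold D; rewrite !Cexp_diff_pow, <- Csum_plus.
      set (a := RtoC (-1) ^ n).
      set (f := fun k => if Nat.eqb k n then RtoC 0 else
        RtoC (-1) ^ k * RtoC (binom (2 * n) k) * Ccos (RtoC (2 * (INR n - INR k)) * t)).
      (* The constant that comes from the linear term of [Heven] is the binomial term [k = n], of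
         frequency 0. It carries the sign [a = (-1) ^ n], which the outer factor [a] cancels. *)
      match goal with |- _ = a * ?X => replace X with
        (Csum (fun k => (if Nat.eqb k n then a * RtoC (binom (2 * n) n) else 0) + f k) (2 * n)) end.
      * rewrite Csum_plus, Csum_delta, (proj2 (Nat.leb_le n (2 * n))) by lia.
        transitivity ((a * a) * RtoC (binom (2 * n) n) + a * Csum f (2 * n)); [|ring].
        replace (a * a) with (RtoC 1) by (symmetry; apply Cpow_opp1_sqr); unfold f; ring.
      * rewrite <- Csum_scal; apply Csum_ext; unfold f.
        intros k _.
        replace (INR (2 * n) - 2 * INR k)%R with (2 * (INR n - INR k))%R
          by (rewrite mult_INR; simpl; ring).
        set (d := RtoC (2 * (INR n - INR k))).
        destruct (Nat.eqb_spec k n) as [->|_].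
        -- unfold d, a; rewrite Rminus_diag, Rmult_0_r, !Cmult_0_l, Cexp_0; field.
        -- unfold Ccos.
           replace (Ci * (d * t)) with (d * (Ci * t)) by ring.
           replace (- (d * (Ci * t))) with (d * - (Ci * t)) by ring; field.
    + rewrite Csin_alt; fold D; rewrite !Cpow_mult_r.
      replace ((- D) ^ 2) with (D ^ 2) by ring.
      replace ((- Ci * (D / RtoC 2)) ^ 2) with (RtoC (-1) * (D ^ 2 * / RtoC 4)).
      * rewrite !Cpow_mult_l, Cpow_inv by (apply RtoC_nz; lra).
        field; apply Cpow_nz, RtoC_nz; lra.
      * transitivity ((Ci * Ci) * (D ^ 2 * / RtoC 4)); [rewrite Ci_sqr, RtoC_opp1; ring | field].
Qed.

(** * Complex series *)

(** The Taylor coefficients of [1 / sqrt (1 - x)]. *)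
Definition cbin (k : nat) : R := (binom (2 * k) k / 4 ^ k)%R.

Lemma cbin_0 : cbin 0 = 1%R.
Proof. unfold cbin; simpl; rewrite C_n_0; field. Qed.

(** The recurrence behind the positivity of [cbin], its bound by 1 and the differential equation
    [bcoef_ode]. *)
Lemma cbin_S (k : nat) :
  (cbin (S k) * (2 * INR k + 2) = cbin k * (2 * INR k + 1))%R.
Proof.
  unfold cbin, Binomial.C.
  replace (2 * S k - S k)%nat with (S k) by lia.
  replace (2 * k - k)%nat with k by lia.
  replace (2 * S k)%nat with (S (S (2 * k))) by lia.
  rewrite !fact_simpl, !mult_INR, !S_INR, mult_INR; simpl (INR 2).
  pose proof (INR_fact_neq_0 k); pose proof (pos_INR k).
  simpl pow; field; repeat split; trivial; try lra; apply pow_nonzero; lra.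
Qed.

Lemma cbin_pos (k : nat) : 0 < cbin k.
Proof.
  induction k as [|k IH]; [rewrite cbin_0; lra|].
  pose proof (cbin_S k); pose proof (pos_INR k); nra.
Qed.

Lemma cbin_le1 (k : nat) : cbin k <= 1.
Proof.
  induction k as [|k IH]; [rewrite cbin_0; lra|].
  pose proof (cbin_S k); pose proof (pos_INR k); pose proof (cbin_pos (S k)); nra.
Qed.

Definition Cis_series (c : nat -> C) (v : C) : Prop :=
  is_series (V := C_NormedModule) c v.

Lemma Re_sum_n (c : nat -> C) (N : nat) :
  Re (Csum c N) = sum_n (fun k => Re (c k)) N.
Proof.
  induction N as [|N IH]; [now rewrite Csum_0, sum_O|].
  rewrite Csum_S, sum_Sn, <- IH; reflexivity.
Qed.

Lemma Im_sum_n (c : nat -> C) (N : nat) :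
  Im (Csum c N) = sum_n (fun k => Im (c k)) N.
Proof.
  induction N as [|N IH]; [now rewrite Csum_0, sum_O|].
  rewrite Csum_S, sum_Sn, <- IH; reflexivity.
Qed.

(** The uniform structure of [C] is that of a product, so a ball around [v] is a pair of balls
    around its coordinates. *)
Lemma Cis_series_iff (c : nat -> C) (v : C) :
  Cis_series c v <->
  is_series (fun k => Re (c k)) (Re v) /\ is_series (fun k => Im (c k)) (Im v).
Proof.
  unfold Cis_series, is_series; split.
  - intros H; split.
    + apply (filterlim_ext (fun N => Re (Csum c N))); [apply Re_sum_n|].
      apply (filterlim_comp _ _ _ (Csum c) Re _ _ _ H).
      apply filterlim_locally; intros eps; exists eps; now intros y [Hy _].
    + apply (filterlim_ext (fun N => Im (Csum c N))); [apply Im_sum_n|].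
      apply (filterlim_comp _ _ _ (Csum c) Im _ _ _ H).
      apply filterlim_locally; intros eps; exists eps; now intros y [_ Hy].
  - intros [H1 H2]; apply filterlim_locally; intros eps.
    pose proof (proj1 (filterlim_locally _ _) H1 eps) as E1.
    pose proof (proj1 (filterlim_locally _ _) H2 eps) as E2.
    generalize (filter_and _ _ E1 E2); apply filter_imp; intros N [B1 B2].
    rewrite <- Re_sum_n in B1; rewrite <- Im_sum_n in B2; split; assumption.
Qed.

Lemma Cis_series_clim (c : nat -> C) (v : C) :
  Cis_series c v <-> clim (Csum c) v.
Proof.
  rewrite Cis_series_iff; split; intros [H1 H2]; split.
  - apply is_lim_seq_ext with (2 := H1); intros; symmetry; apply Re_sum_n.
  - apply is_lim_seq_ext with (2 := H2); intros; symmetry; apply Im_sum_n.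
  - apply is_lim_seq_ext with (2 := H1); intros; apply Re_sum_n.
  - apply is_lim_seq_ext with (2 := H2); intros; apply Im_sum_n.
Qed.

Lemma Cis_series_unique (c : nat -> C) (v w : C) :
  Cis_series c v -> Cis_series c w -> v = w.
Proof. rewrite !Cis_series_clim; apply clim_unique. Qed.

Lemma Cis_series_ext (c d : nat -> C) (v : C) :
  (forall k, c k = d k) -> Cis_series c v -> Cis_series d v.
Proof. exact (is_series_ext (V := C_NormedModule) c d v). Qed.

Lemma Cis_series_plus (c d : nat -> C) (v w : C) :
  Cis_series c v -> Cis_series d w -> Cis_series (fun k => c k + d k) (v + w).
Proof. exact (is_series_plus (V := C_NormedModule) c d v w). Qed.

Lemma Cis_series_scal (a : C) (c : nat -> C) (v : C) :
  Cis_series c v -> Cis_series (fun k => a * c k) (a * v).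
Proof. exact (is_series_scal (V := C_NormedModule) a c v). Qed.

Lemma Cis_series_incr_1 (c : nat -> C) (v : C) :
  Cis_series (fun k => c (S k)) v <-> Cis_series c (v + c 0%nat).
Proof.
  split; intros H.
  - apply (is_series_decr_1 (V := C_NormedModule)).
    match goal with |- is_series _ ?X => assert (E : X = v) end.
    + change (v + c 0%nat + - c 0%nat = v); ring.
    + rewrite E; exact H.
  - exact (is_series_incr_1 (V := C_NormedModule) c v H).
Qed.

(** The limit is taken in the squared moduli, which are polynomials in the coordinates. *)
Lemma clim_Cmod_le (u : nat -> C) (l : C) (M : R) :
  clim u l -> (forall j, Cmod (u j) <= M) -> Cmod l <= M.
Proof.
  intros [H1 H2] HM.
  assert (HM0 : 0 <= M) by (eapply Rle_trans; [apply (Cmod_ge_0 (u 0%nat)) | apply HM]).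
  assert (Cmod l * Cmod l <= M * M)%R.
  { rewrite Cmod_sqr.
    apply (is_lim_seq_le (fun j => Re (u j) * Re (u j) + Im (u j) * Im (u j))%R
             (fun _ => (M * M)%R) (Re l * Re l + Im l * Im l)%R (M * M)%R).
    - intros j; rewrite <- Cmod_sqr; apply Rmult_le_compat; auto; apply Cmod_ge_0.
    - apply is_lim_seq_plus'; now apply is_lim_seq_mult'.
    - apply is_lim_seq_const. }
  pose proof (Cmod_ge_0 l); nra.
Qed.

(** Built from the total function [Series], so it is known to be the sum only once convergence is
    shown, as in [CSeries_correct]. *)
Definition CSeries (c : nat -> C) : C :=
  (Series (fun k => Re (c k)), Series (fun k => Im (c k))).

Lemma Cmod_Csum (c : nat -> C) (N : nat) :
  Cmod (Csum c N) <= sum_n (fun k => Cmod (c k)) N.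
Proof.
  induction N as [|N IH]; [rewrite Csum_0, sum_O; lra|].
  rewrite Csum_S, sum_Sn; eapply Rle_trans; [apply Cmod_triangle|].
  apply Rplus_le_compat_r, IH.
Qed.

Lemma Re_le_Cmod (c : C) : Rabs (Re c) <= Cmod c.
Proof. eapply Rle_trans; [apply Rmax_l | apply Rmax_Cmod]. Qed.

Lemma Im_le_Cmod (c : C) : Rabs (Im c) <= Cmod c.
Proof. eapply Rle_trans; [apply Rmax_r | apply Rmax_Cmod]. Qed.

Lemma CSeries_correct (c : nat -> C) (a : nat -> R) :
  (forall k, Cmod (c k) <= a k) -> ex_series a -> Cis_series c (CSeries c).
Proof.
  intros Hc Ha; apply Cis_series_iff; split; apply Series_correct;
    apply (ex_series_le (V := R_CompleteNormedModule) _ a); trivial; intros k;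
    (eapply Rle_trans; [|apply Hc]); [apply Re_le_Cmod | apply Im_le_Cmod].
Qed.

Lemma sum_n_le_Series (a : nat -> R) (N : nat) :
  (forall k, 0 <= a k) -> ex_series a -> sum_n a N <= Series a.
Proof.
  intros H0 Ha; apply (is_lim_seq_incr_compare (sum_n a)).
  - apply Series_correct in Ha; exact Ha.
  - intros j; rewrite sum_Sn; unfold plus; simpl; pose proof (H0 (S j)); lra.
Qed.

Lemma Cis_series_Cmod_le (c : nat -> C) (a : nat -> R) (v : C) :
  Cis_series c v -> (forall k, Cmod (c k) <= a k) -> ex_series a ->
  Cmod v <= Series a.
Proof.
  intros Hv Hc Ha; apply Cis_series_clim in Hv.
  apply (clim_Cmod_le (Csum c)); trivial; intros N.
  eapply Rle_trans; [apply Cmod_Csum|].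
  eapply Rle_trans; [apply sum_n_m_le, Hc|].
  apply sum_n_le_Series; trivial; intros k.
  eapply Rle_trans; [apply Cmod_ge_0 | apply Hc].
Qed.

(** The variable is real and only the coefficients are complex: powers of a complex point are put
    into [c], so that the theory of [PSeries] applies to each coordinate. *)
Definition CPSeries (c : nat -> C) (x : R) : C :=
  CSeries (fun k => RtoC (x ^ k) * c k).

Lemma Cmod_RtoC_mult (x : R) (c : C) : Cmod (RtoC x * c) = (Rabs x * Cmod c)%R.
Proof. now rewrite Cmod_mult, Cmod_R. Qed.

Lemma CPSeries_correct (c : nat -> C) (x : R) :
  (forall k, Cmod (c k) <= 1) -> Rabs x < 1 ->
  Cis_series (fun k => RtoC (x ^ k) * c k) (CPSeries c x).
Proof.
  intros Hc Hx; apply CSeries_correct with (fun k => (Rabs x ^ k)%R).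
  - intros k; rewrite Cmod_RtoC_mult, <- RPow_abs.
    rewrite <- Rmult_1_r; apply Rmult_le_compat_l; [apply pow_le, Rabs_pos | apply Hc].
  - apply ex_series_geom; now rewrite Rabs_Rabsolu.
Qed.

Lemma CV_radius_bounded_1 (a : nat -> R) (x : R) :
  (forall k, Rabs (a k) <= 1) -> Rabs x < 1 -> Rbar_lt (Rabs x) (CV_radius a).
Proof.
  intros Ha Hx; apply Rbar_lt_le_trans with 1%R; [exact Hx|].
  apply (CV_radius_bounded a); exists 1%R; intros k.
  rewrite pow1, Rmult_1_r; apply Ha.
Qed.

Definition PSd (c : nat -> C) (k : nat) : C := RtoC (INR (S k)) * c (S k).

Lemma CPSeries_PSeries (c : nat -> C) (x : R) :
  CPSeries c x = (PSeries (fun k => Re (c k)) x, PSeries (fun k => Im (c k)) x).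
Proof.
  unfold CPSeries, CSeries, PSeries; f_equal; apply Series_ext; intros k;
    simpl; unfold Re, Im; ring.
Qed.

(** Termwise differentiation inside the radius of convergence, which is at least 1 for both
    coordinates. The coefficients [PSd c] may exceed 1, so convergence of the derived series is
    drawn from that radius and not from [CPSeries_correct]. *)
Lemma CPSeries_derive (c : nat -> C) (x : R) :
  (forall k, Cmod (c k) <= 1) -> Rabs x < 1 ->
  cderiv (CPSeries c) x (CPSeries (PSd c) x) /\
  Cis_series (fun k => RtoC (x ^ k) * PSd c k) (CPSeries (PSd c) x).
Proof.
  intros Hc Hx.
  assert (H1 : Rbar_lt (Rabs x) (CV_radius (fun k => Re (c k)))).
  { apply CV_radius_bounded_1; trivial; intros k.
    eapply Rle_trans; [apply Re_le_Cmod | apply Hc]. }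
  assert (H2 : Rbar_lt (Rabs x) (CV_radius (fun k => Im (c k)))).
  { apply CV_radius_bounded_1; trivial; intros k.
    eapply Rle_trans; [apply Im_le_Cmod | apply Hc]. }
  assert (E1 : forall k, PS_derive (fun k => Re (c k)) k = Re (PSd c k)).
  { intros k; unfold PS_derive, PSd.
    change (INR (S k) * Re (c (S k)) = INR (S k) * Re (c (S k)) - 0 * Im (c (S k)))%R; ring. }
  assert (E2 : forall k, PS_derive (fun k => Im (c k)) k = Im (PSd c k)).
  { intros k; unfold PS_derive, PSd.
    change (INR (S k) * Im (c (S k)) = INR (S k) * Im (c (S k)) + 0 * Re (c (S k)))%R; ring. }
  split; [split|].
  - apply is_derive_ext with (PSeries (fun k => Re (c k))).
    { intros t; now rewrite CPSeries_PSeries. }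
    eapply is_derive_val; [now apply is_derive_PSeries|].
    rewrite CPSeries_PSeries; now apply PSeries_ext.
  - apply is_derive_ext with (PSeries (fun k => Im (c k))).
    { intros t; now rewrite CPSeries_PSeries. }
    eapply is_derive_val; [now apply is_derive_PSeries|].
    rewrite CPSeries_PSeries; now apply PSeries_ext.
  - rewrite CPSeries_PSeries; apply Cis_series_iff; split.
    + change (is_series (fun k => Re (RtoC (x ^ k) * PSd c k))
                (PSeries (fun k => Re (PSd c k)) x)).
      rewrite <- (PSeries_ext _ _ x E1); rewrite <- CV_radius_derive in H1.
      apply CV_radius_inside, PSeries_correct in H1.
      eapply is_series_ext; [|exact H1].
      intros k; rewrite pow_n_pow, E1.
      change (x ^ k * Re (PSd c k) = x ^ k * Re (PSd c k) - 0 * Im (PSd c k))%R; ring.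
    + change (is_series (fun k => Im (RtoC (x ^ k) * PSd c k))
                (PSeries (fun k => Im (PSd c k)) x)).
      rewrite <- (PSeries_ext _ _ x E2); rewrite <- CV_radius_derive in H2.
      apply CV_radius_inside, PSeries_correct in H2.
      eapply is_series_ext; [|exact H2].
      intros k; rewrite pow_n_pow, E2.
      change (x ^ k * Im (PSd c k) = x ^ k * Im (PSd c k) + 0 * Re (PSd c k))%R; ring.
Qed.

(** The operator [x d/dx] multiplies the coefficient of index [k] by [k]; it turns relations between
    coefficients into differential equations. *)
Lemma CPSeries_euler (c : nat -> C) (x : R) :
  (forall k, Cmod (c k) <= 1) -> Rabs x < 1 ->
  Cis_series (fun k => RtoC (x ^ k) * (RtoC (INR k) * c k))
    (RtoC x * CPSeries (PSd c) x).
Proof.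
  intros Hc Hx; destruct (CPSeries_derive c x Hc Hx) as [_ H].
  (* The added term of index 0 is zero and permits the shift of index. *)
  replace (RtoC x * CPSeries (PSd c) x)
    with (RtoC x * CPSeries (PSd c) x + RtoC (x ^ 0) * (RtoC (INR 0) * c 0%nat))
    by (simpl INR; ring).
  apply (Cis_series_incr_1 (fun k => RtoC (x ^ k) * (RtoC (INR k) * c k))).
  eapply Cis_series_ext; [|exact (Cis_series_scal (RtoC x) _ _ H)].
  intros k; unfold PSd; change (x ^ S k)%R with (x * x ^ k)%R.
  rewrite RtoC_mult; ring.
Qed.

(** * Power series with central binomial coefficients *)

(** The terms of [F_m(z)]; as coefficients of a power series in a real [x] they give [F_m(x z)]. *)
Definition coef (z : C) (m k : nat) : C :=
  RtoC (cbin k / (2 * INR k + INR m + 1)) * z ^ k.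

(** The coefficients, in a real [x], of [1 / sqrt (1 - x z)]. *)
Definition bcoef (z : C) (k : nat) : C := RtoC (cbin k) * z ^ k.

Lemma Cmod_pow_le1 (z : C) (k : nat) : Cmod z <= 1 -> Cmod (z ^ k) <= 1.
Proof.
  intros Hz; rewrite Cmod_pow, <- (pow1 k); apply pow_incr; split;
    [apply Cmod_ge_0 | exact Hz].
Qed.

(** A majorant that depends on neither [z] nor [m]; it is the arcsine coefficient, later shown to be
    summable. *)
Lemma Cmod_coef (z : C) (m k : nat) : Cmod z <= 1 ->
  Cmod (coef z m k) <= cbin k / (2 * INR k + 1).
Proof.
  intros Hz; unfold coef.
  pose proof (cbin_pos k) as Hb; pose proof (pos_INR k); pose proof (pos_INR m).
  rewrite Cmod_RtoC_mult, Rabs_pos_eq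
    by (apply Rmult_le_pos; [lra | left; apply Rinv_0_lt_compat; lra]).
  pose proof (Cmod_pow_le1 z k Hz) as Hk; pose proof (Cmod_ge_0 (z ^ k)).
  rewrite <- Rmult_1_r; apply Rmult_le_compat; trivial.
  - apply Rmult_le_pos; [lra | left; apply Rinv_0_lt_compat; lra].
  - apply Rmult_le_compat_l; [lra|]; apply Rinv_le_contravar; lra.
Qed.

Lemma Cmod_coef_le1 (z : C) (m k : nat) : Cmod z <= 1 -> Cmod (coef z m k) <= 1.
Proof.
  intros Hz; eapply Rle_trans; [now apply Cmod_coef|].
  pose proof (cbin_le1 k); pose proof (pos_INR k).
  apply Rmult_le_reg_r with (2 * INR k + 1)%R; [lra|].
  unfold Rdiv; rewrite Rmult_assoc, Rinv_l; lra.
Qed.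

Lemma Cmod_bcoef_le1 (z : C) (k : nat) : Cmod z <= 1 -> Cmod (bcoef z k) <= 1.
Proof.
  intros Hz; unfold bcoef; rewrite Cmod_RtoC_mult.
  pose proof (cbin_pos k); pose proof (cbin_le1 k).
  pose proof (Cmod_pow_le1 z k Hz); pose proof (Cmod_ge_0 (z ^ k)).
  rewrite Rabs_pos_eq; nra.
Qed.

(** Coefficientwise this says that the factor [2 k + m + 1] cancels the denominator of [coef]. *)
Lemma coef_ode (z : C) (m : nat) (x : R) : Cmod z <= 1 -> Rabs x < 1 ->
  RtoC 2 * (RtoC x * CPSeries (PSd (coef z m)) x)
  + RtoC (INR m + 1) * CPSeries (coef z m) x = CPSeries (bcoef z) x.
Proof.
  intros Hz Hx.
  pose proof (CPSeries_euler (coef z m) x (fun k => Cmod_coef_le1 z m k Hz) Hx) as H1.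
  pose proof (CPSeries_correct (coef z m) x (fun k => Cmod_coef_le1 z m k Hz) Hx) as H2.
  pose proof (CPSeries_correct (bcoef z) x (fun k => Cmod_bcoef_le1 z k Hz) Hx) as H3.
  eapply Cis_series_unique; [|exact H3].
  eapply Cis_series_ext; [|apply Cis_series_plus;
    apply Cis_series_scal; [exact H1 | exact H2]].
  intros k; simpl.
  replace (bcoef z k) with (RtoC (2 * INR k + INR m + 1) * coef z m k).
  - rewrite !RtoC_plus, RtoC_mult; ring.
  - unfold coef, bcoef; rewrite Cmult_assoc, <- RtoC_mult; do 2 f_equal.
    pose proof (pos_INR k); pose proof (pos_INR m); field; lra.
Qed.

(** The recurrence [cbin_S] in terms of series: the differential equation of
    [(1 - x z) ^ (-1/2)]. *)
Lemma bcoef_ode (z : C) (x : R) : Cmod z <= 1 -> Rabs x < 1 ->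
  (RtoC 1 - RtoC x * z) * CPSeries (PSd (bcoef z)) x
  = z / RtoC 2 * CPSeries (bcoef z) x.
Proof.
  intros Hz Hx.
  pose proof (CPSeries_euler (bcoef z) x (fun k => Cmod_bcoef_le1 z k Hz) Hx) as H1.
  pose proof (CPSeries_correct (bcoef z) x (fun k => Cmod_bcoef_le1 z k Hz) Hx) as H2.
  destruct (CPSeries_derive (bcoef z) x (fun k => Cmod_bcoef_le1 z k Hz) Hx) as [_ H3].
  assert (E : CPSeries (PSd (bcoef z)) x =
    z * (RtoC x * CPSeries (PSd (bcoef z)) x) + z / RtoC 2 * CPSeries (bcoef z) x).
  { eapply Cis_series_unique; [exact H3|].
    eapply Cis_series_ext; [|apply Cis_series_plus;
      apply Cis_series_scal; [exact H1 | exact H2]].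
    intros k; unfold PSd, bcoef; rewrite Cpow_S.
    replace (RtoC (INR (S k)) * (RtoC (cbin (S k)) * (z * z ^ k)))
      with (RtoC (cbin k * (2 * INR k + 1)) * / RtoC 2 * (z * z ^ k)).
    - rewrite RtoC_mult, RtoC_plus, RtoC_mult; field.
    - rewrite <- cbin_S, S_INR, !RtoC_mult, !RtoC_plus, RtoC_mult.
      replace (RtoC 2) with (RtoC 1 + RtoC 1) by (rewrite <- RtoC_plus; reflexivity).
      field. }
  transitivity (CPSeries (PSd (bcoef z)) x
    - z * (RtoC x * CPSeries (PSd (bcoef z)) x)); [ring|].
  rewrite E at 1; ring.
Qed.

(** * Curves along the ray [r w] *)

Lemma cderiv_comp (f : R -> C) (g : R -> R) (s m : R) (l : C) :
  cderiv f (g s) l -> is_derive g s m -> cderiv (fun r => f (g r)) s (RtoC m * l).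
Proof.
  intros [H1 H2] Hg; split.
  - eapply is_derive_val; [exact (is_derive_Rcomp (fun r => Re (f r)) g s _ m H1 Hg)|].
    simpl; unfold Re; ring.
  - eapply is_derive_val; [exact (is_derive_Rcomp (fun r => Im (f r)) g s _ m H2 Hg)|].
    simpl; unfold Im; ring.
Qed.

Lemma cderiv_pow (f : R -> C) (s : R) (l : C) (k : nat) :
  cderiv f s l ->
  cderiv (fun r => f r ^ S k) s (RtoC (INR k + 1) * f s ^ k * l).
Proof.
  intros H; induction k as [|k IH].
  - apply cderiv_ext with f; [intros; simpl; ring|].
    eapply cderiv_val; [exact H|]; simpl; rewrite Rplus_0_l; ring.
  - eapply cderiv_val; [exact (cderiv_mult f (fun r => f r ^ S k) s _ _ H IH)|].
    rewrite S_INR, !RtoC_plus, !Cpow_S; ring.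
Qed.

(* The branch of [1 / sqrt (1 - r ^ 2 z)] that equals 1 at [r = 0]. *)
Definition Beta (z : C) (r : R) : C := CPSeries (bcoef z) (r ^ 2).

(* The primitive of [s ^ m / sqrt (1 - s ^ 2)], evaluated at [s = r w]. *)
Definition Phi (w : C) (m : nat) (r : R) : C :=
  (RtoC r * w) ^ S m * CPSeries (coef (w * w) m) (r ^ 2).

Lemma is_derive_sqr (r : R) : is_derive (fun s => s ^ 2)%R r (2 * r)%R.
Proof. auto_derive; [trivial | ring]. Qed.

Lemma cderiv_line (w : C) (r : R) : cderiv (fun s => RtoC s * w) r w.
Proof.
  eapply cderiv_val.
  - apply (cderiv_mult (fun s => RtoC s) (fun _ => w)).
    + apply (cderiv_real (fun s => s) r 1%R), (is_derive_id (K := R_AbsRing)).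
    + apply cderiv_const.
  - ring.
Qed.

Lemma sqr_lt1 (r : R) : 0 <= r < 1 -> Rabs (r ^ 2) < 1.
Proof. intros Hr; rewrite Rabs_pos_eq; nra. Qed.

Lemma Cmod_sqr_le1 (w : C) : Cmod w <= 1 -> Cmod (w * w) <= 1.
Proof. intros Hw; rewrite Cmod_mult; pose proof (Cmod_ge_0 w); nra. Qed.

(** By the chain rule at [x = r ^ 2] the derivative is [(r w) ^ m w] times the left-hand side of
    [coef_ode]. *)
Lemma Phi_derive (w : C) (m : nat) (r : R) : Cmod w <= 1 -> 0 <= r < 1 ->
  cderiv (Phi w m) r ((RtoC r * w) ^ m * (w * Beta (w * w) r)).
Proof.
  intros Hw Hr; apply Cmod_sqr_le1 in Hw; pose proof (sqr_lt1 r Hr) as Hx.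
  unfold Beta; rewrite <- (coef_ode (w * w) m (r ^ 2) Hw Hx).
  destruct (CPSeries_derive (coef (w * w) m) (r ^ 2)
              (fun k => Cmod_coef_le1 _ m k Hw) Hx) as [Hd _].
  eapply cderiv_val.
  - apply (cderiv_mult (fun s => (RtoC s * w) ^ S m)
             (fun s => CPSeries (coef (w * w) m) (s ^ 2))).
    + apply (cderiv_pow (fun s => RtoC s * w)), cderiv_line.
    + apply (cderiv_comp _ (fun s => s ^ 2)%R); [exact Hd | apply is_derive_sqr].
  - cbv beta; set (D := CPSeries (PSd _) _); set (F := CPSeries _ _).
    rewrite RtoC_pow, RtoC_mult, !Cpow_S; ring.
Qed.

(** The derivative is characterised by the differential equation, which avoids a division by
    [1 - r ^ 2 z]. *)
Lemma Beta_derive (z : C) (r : R) : Cmod z <= 1 -> 0 <= r < 1 ->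
  exists B' : C, cderiv (Beta z) r B' /\
    (RtoC 1 - RtoC r ^ 2 * z) * B' = RtoC r * z * Beta z r.
Proof.
  intros Hz Hr; pose proof (sqr_lt1 r Hr) as Hx.
  destruct (CPSeries_derive (bcoef z) (r ^ 2)
              (fun k => Cmod_bcoef_le1 _ k Hz) Hx) as [Hd _].
  exists (RtoC (2 * r) * CPSeries (PSd (bcoef z)) (r ^ 2)); split.
  - apply (cderiv_comp _ (fun s => s ^ 2)%R); [exact Hd | apply is_derive_sqr].
  - pose proof (bcoef_ode z (r ^ 2) Hz Hx) as E; unfold Beta.
    set (D := CPSeries (PSd _) _) in *; set (F := CPSeries _ _) in *.
    rewrite <- RtoC_pow, RtoC_mult.
    transitivity (RtoC 2 * RtoC r * ((RtoC 1 - RtoC (r ^ 2) * z) * D)); [ring|].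
    rewrite E; field.
Qed.

Lemma CPSeries_at_0 (c : nat -> C) : CPSeries c 0 = c 0%nat.
Proof.
  rewrite CPSeries_PSeries; apply injective_projections;
    simpl; rewrite PSeries_0; reflexivity.
Qed.

Lemma Beta_0 (z : C) : Beta z 0 = 1.
Proof.
  unfold Beta; replace (0 ^ 2)%R with 0%R by ring.
  rewrite CPSeries_at_0.
  unfold bcoef; rewrite cbin_0; simpl; ring.
Qed.

Lemma cderiv_one_minus (z : C) (r : R) :
  cderiv (fun s => RtoC 1 - RtoC s ^ 2 * z) r (- (RtoC 2 * RtoC r * z)).
Proof.
  apply cderiv_ext with (fun s => RtoC 1 + (- z) * RtoC (s ^ 2)).
  { intros s; rewrite RtoC_pow; ring. }
  eapply cderiv_val.
  - apply (cderiv_plus (fun _ => RtoC 1) (fun s => - z * RtoC (s ^ 2)));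
      [apply cderiv_const |].
    apply (cderiv_scal (- z) (fun s => RtoC (s ^ 2))).
    apply (cderiv_real (fun s => s ^ 2)%R), is_derive_sqr.
  - rewrite RtoC_mult; ring.
Qed.

(** The left-hand side has zero derivative by [Beta_derive] and equals 1 at the origin. *)
Lemma Beta_sqr (z : C) (r : R) : Cmod z <= 1 -> 0 <= r < 1 ->
  Beta z r * Beta z r * (RtoC 1 - RtoC r ^ 2 * z) = 1.
Proof.
  intros Hz Hr.
  transitivity (Beta z 0 * Beta z 0 * (RtoC 1 - RtoC 0 ^ 2 * z)).
  - apply (cderiv_0_const
      (fun s => Beta z s * Beta z s * (RtoC 1 - RtoC s ^ 2 * z)) r 1); trivial.
    intros s Hs; destruct (Beta_derive z s Hz Hs) as [B' [HB E]].
    eapply cderiv_val.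
    + apply (cderiv_mult (fun s => Beta z s * Beta z s)
               (fun s => RtoC 1 - RtoC s ^ 2 * z));
        [apply cderiv_mult; exact HB | apply cderiv_one_minus].
    + cbv beta.
      transitivity (RtoC 2 * Beta z s * ((RtoC 1 - RtoC s ^ 2 * z) * B')
        - RtoC 2 * RtoC s * z * (Beta z s * Beta z s)).
      * replace (RtoC 2) with (RtoC 1 + RtoC 1) by (rewrite <- RtoC_plus; reflexivity); ring.
      * rewrite E; ring.
  - rewrite Beta_0; simpl; ring.
Qed.

Lemma Phi_0 (w : C) (m : nat) : Phi w m 0 = 0.
Proof. unfold Phi; rewrite Cpow_S; ring. Qed.

(** The power series of arcsin, evaluated at [r w]. *)
Definition Arc (w : C) (r : R) : C := Phi w 0 r.

Lemma Arc_derive (w : C) (r : R) : Cmod w <= 1 -> 0 <= r < 1 ->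
  cderiv (Arc w) r (w * Beta (w * w) r).
Proof.
  intros Hw Hr; eapply cderiv_val; [now apply Phi_derive | simpl; ring].
Qed.

(** Here [e] stands for both [i] and [- i]. The product of the right-hand side with
    [Cexp (- e * Arc w r)] is constant. Writing the root of [1 - r ^ 2 w ^ 2] as that number times
    [Beta] avoids a choice of branch. *)
Lemma Arc_exp (w e : C) (r : R) : Cmod w <= 1 -> 0 <= r < 1 -> e * e = - RtoC 1 ->
  Cexp (e * Arc w r) =
  e * (RtoC r * w) + (RtoC 1 - RtoC r ^ 2 * (w * w)) * Beta (w * w) r.
Proof.
  intros Hw Hr He; pose proof (Cmod_sqr_le1 w Hw) as Hz.
  set (X := fun s => e * (RtoC s * w) + (RtoC 1 - RtoC s ^ 2 * (w * w)) * Beta (w * w) s).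
  change (Cexp (e * Arc w r) = X r).
  assert (H : X r * Cexp (- e * Arc w r) = X 0%R * Cexp (- e * Arc w 0)).
  { apply (cderiv_0_const (fun s => X s * Cexp (- e * Arc w s)) r 1); trivial.
    intros s Hs; destruct (Beta_derive (w * w) s Hz Hs) as [B' [HB E]].
    pose proof (Beta_sqr (w * w) s Hz Hs) as ES.
    eapply cderiv_val.
    - apply (cderiv_mult X (fun s => Cexp (- e * Arc w s))).
      + apply (cderiv_plus (fun s => e * (RtoC s * w))
           (fun s => (RtoC 1 - RtoC s ^ 2 * (w * w)) * Beta (w * w) s)).
        * apply (cderiv_scal e (fun s => RtoC s * w)), cderiv_line.
        * apply (cderiv_mult (fun s => RtoC 1 - RtoC s ^ 2 * (w * w)));
            [apply cderiv_one_minus | exact HB].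
      + apply (cderiv_Cexp (fun s => - e * Arc w s)), cderiv_scal.
        now apply Arc_derive.
    - cbv beta; rewrite E; unfold X.
      set (B := Beta (w * w) s) in *; set (q := RtoC 1 - RtoC s ^ 2 * (w * w)) in *.
      set (x := Cexp _).
      (* Both brackets vanish: the first by [Beta_sqr], the second because [e * e = - 1]. *)
      transitivity (x * (e * w * (RtoC 1 - B * B * q)
        - w * w * RtoC s * B * (RtoC 1 + e * e))).
      + replace (RtoC 2) with (RtoC 1 + RtoC 1) by (rewrite <- RtoC_plus; reflexivity); ring.
      + rewrite ES, He; ring. }
  transitivity (X r * Cexp (- e * Arc w r) * Cexp (e * Arc w r)).
  - rewrite H; unfold Arc, X; rewrite Phi_0, Cmult_0_r, Cexp_0, Beta_0.
    simpl; ring.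
  - rewrite <- Cmult_assoc, <- Cexp_plus.
    replace (- e * Arc w r + e * Arc w r) with (RtoC 0) by ring.
    rewrite Cexp_0; ring.
Qed.

Lemma Arc_sin (w : C) (r : R) : Cmod w <= 1 -> 0 <= r < 1 ->
  Csin (Arc w r) = RtoC r * w.
Proof.
  intros Hw Hr; unfold Csin.
  replace (- (Ci * Arc w r)) with (- Ci * Arc w r) by ring.
  rewrite !Arc_exp; trivial; [field; apply Ci_nz | | apply Ci_sqr].
  rewrite <- Ci_sqr; ring.
Qed.

(** The substitution [s = sin t]: since [Csin (Arc w r) = r w], both sides have derivative
    [(r w) ^ m w Beta], and both vanish at the origin. *)
Lemma Phi_eq (w : C) (m : nat) (H : C -> C) (r : R) :
  Cmod w <= 1 -> 0 <= r < 1 -> H 0 = 0 -> hol H (fun t => Csin t ^ m) ->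
  Phi w m r = H (Arc w r).
Proof.
  intros Hw Hr H0 [HH _].
  assert (E : Phi w m r - H (Arc w r) = Phi w m 0 - H (Arc w 0)).
  { apply (cderiv_0_const (fun s => Phi w m s - H (Arc w s)) r 1); trivial.
    intros s Hs; apply cderiv_ext with (fun s => Phi w m s + - RtoC 1 * H (Arc w s)).
    { intros; ring. }
    eapply cderiv_val.
    - apply cderiv_plus; [now apply Phi_derive|].
      apply cderiv_scal, HH; now apply Arc_derive.
    - rewrite Arc_sin by trivial; ring. }
  unfold Arc in E at 2; rewrite !Phi_0, H0 in E.
  transitivity (Phi w m r - H (Arc w r) + H (Arc w r)); [ring | rewrite E; ring].
Qed.

(** * The endpoint of a ray *)

Lemma psum_lim (q : nat -> R) (x : nat -> R) (N : nat) :
  is_lim_seq x 1%R ->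
  is_lim_seq (fun j => sum_n (fun k => q k * x j ^ k)%R N) (sum_n q N).
Proof.
  intros Hlim.
  assert (Hp : forall k, is_lim_seq (fun j => q k * x j ^ k)%R (q k)).
  { intros k; rewrite <- (Rmult_1_r (q k)) at 1; rewrite <- (pow1 k) at 1.
    apply is_lim_seq_mult'; [apply is_lim_seq_const|].
    induction k as [|k IH]; simpl; [apply is_lim_seq_const | now apply is_lim_seq_mult']. }
  induction N as [|N IH].
  - rewrite sum_O; apply is_lim_seq_ext with (2 := Hp 0%nat); intros; now rewrite sum_O.
  - rewrite sum_Sn; eapply is_lim_seq_ext; [|apply (is_lim_seq_plus' _ _ _ _ IH (Hp (S N)))].
    intros; simpl; now rewrite sum_Sn.
Qed.

(** The majorant makes the convergence uniform on the closed unit interval. With [N] chosen so that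
    the tail [T] of [a] is below [eps / 3], the tails at [x j] and at 1 are at most [T], and the
    partial sums are polynomials. *)
Lemma PSeries_dominated_lim (q a : nat -> R) (x : nat -> R) :
  (forall k, Rabs (q k) <= a k) -> ex_series a ->
  (forall j, 0 <= x j <= 1) -> is_lim_seq x 1%R ->
  is_lim_seq (fun j => PSeries q (x j)) (Series q).
Proof.
  intros Hq Ha Hx Hlim; apply is_lim_seq_spec; intros eps.
  pose proof (Series_correct _ Ha) as HS; unfold is_series in HS.
  change (is_lim_seq (sum_n a) (Series a)) in HS.
  apply is_lim_seq_spec in HS.
  assert (He : 0 < eps / 3) by (pose proof (cond_pos eps); lra).
  destruct (HS (mkposreal _ He)) as [N HN]; specialize (HN N (Nat.le_refl N)); simpl in HN.
  pose proof (Series_incr_n a (S N) (Nat.lt_0_succ N) Ha) as ET; simpl pred in ET.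
  rewrite <- sum_n_Reals in ET.
  set (T := Series (fun k => a (S N + k)%nat)) in *.
  assert (HaN : ex_series (fun k => a (S N + k)%nat))
    by (now apply (ex_series_incr_n (V := R_NormedModule))).
  assert (Htail : forall y, 0 <= y <= 1 ->
    Rabs (PSeries q y - sum_n (fun k => q k * y ^ k)%R N) <= T).
  { intros y Hy.
    assert (Hd : forall k, Rabs (q k * y ^ k) <= a k).
    { intros k; rewrite Rabs_mult, <- (Rmult_1_r (a k)).
      apply Rmult_le_compat; try apply Rabs_pos; [apply Hq|].
      rewrite Rabs_pos_eq by (apply pow_le; lra).
      rewrite <- (pow1 k); apply pow_incr; lra. }
    assert (Hex : ex_series (fun k => q k * y ^ k)%R)
      by (apply (ex_series_le (V := R_CompleteNormedModule) _ a); [exact Hd | exact Ha]).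
    unfold PSeries; rewrite (Series_incr_n _ (S N) (Nat.lt_0_succ N) Hex); simpl pred.
    rewrite <- sum_n_Reals.
    match goal with |- Rabs (?u + ?v - _) <= _ => replace (u + v - u)%R with v by ring end.
    assert (Hab : ex_series (fun k => Rabs (q (S N + k)%nat * y ^ (S N + k)))).
    { apply (ex_series_le (V := R_CompleteNormedModule) _ (fun k => a (S N + k)%nat)); trivial.
      intros k; unfold norm; simpl; unfold abs; simpl; rewrite Rabs_Rabsolu; apply Hd. }
    eapply Rle_trans; [now apply Series_Rabs|].
    apply Series_le; trivial; intros k; split; [apply Rabs_pos | apply Hd]. }
  pose proof (psum_lim q x N Hlim) as Hfin.
  apply is_lim_seq_spec in Hfin; destruct (Hfin (mkposreal _ He)) as [J HJ]; simpl in HJ.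
  exists J; intros j Hj; specialize (HJ j Hj).
  pose proof (Htail (x j) (Hx j)) as T1.
  assert (T2 := Htail 1%R ltac:(lra)).
  rewrite PSeries_1, (sum_n_ext _ q) in T2
    by (intros; rewrite pow1; apply Rmult_1_r).
  assert (HT : T < eps / 3) by (apply Rabs_def2 in HN; lra).
  apply Rabs_def2 in HJ; apply Rabs_le_between in T1; apply Rabs_le_between in T2.
  apply Rabs_def1; lra.
Qed.

Lemma CPSeries_clim (c : nat -> C) (a : nat -> R) (x : nat -> R) :
  (forall k, Cmod (c k) <= a k) -> ex_series a ->
  (forall j, 0 <= x j <= 1) -> is_lim_seq x 1%R ->
  clim (fun j => CPSeries c (x j)) (CSeries c).
Proof.
  intros Hc Ha Hx Hl.
  apply clim_ext with (fun j =>
    (PSeries (fun k => Re (c k)) (x j), PSeries (fun k => Im (c k)) (x j))).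
  { intros; now rewrite CPSeries_PSeries. }
  split; simpl; apply PSeries_dominated_lim with a; trivial; intros k;
    (eapply Rle_trans; [|apply Hc]); [apply Re_le_Cmod | apply Im_le_Cmod].
Qed.

Definition ray (j : nat) : R := (1 - / (INR j + 1))%R.

Lemma ray_bound (j : nat) : 0 <= ray j < 1.
Proof.
  unfold ray; pose proof (pos_INR j) as Hj.
  assert (0 < / (INR j + 1)) by (apply Rinv_0_lt_compat; lra).
  assert (/ (INR j + 1) <= / 1) by (apply Rinv_le_contravar; lra).
  rewrite Rinv_1 in *; lra.
Qed.

Lemma ray_lim : is_lim_seq ray 1%R.
Proof.
  replace (Finite 1) with (Finite (1 - 0)) by (f_equal; ring).
  apply is_lim_seq_minus'; [apply is_lim_seq_const|].
  apply is_lim_seq_ext with (fun j => / INR (S j))%R; [intros; now rewrite S_INR|].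
  apply (is_lim_seq_incr_1 (fun j => / INR j)%R).
  apply (is_lim_seq_inv _ p_infty); [apply is_lim_seq_INR | discriminate].
Qed.

Lemma ray_sqr_lim : is_lim_seq (fun j => ray j ^ 2)%R 1%R.
Proof.
  replace (Finite 1) with (Finite (1 * (1 * 1))) by (f_equal; ring).
  simpl; repeat apply is_lim_seq_mult'; apply ray_lim || apply is_lim_seq_const.
Qed.

(** * The Taylor coefficients of arcsin and the bound [PI / 2] for their sum *)

Definition asin_coef (k : nat) : R := (cbin k / (2 * INR k + 1))%R.

Lemma asin_coef_pos (k : nat) : 0 < asin_coef k.
Proof.
  apply Rdiv_lt_0_compat; [apply cbin_pos | pose proof (pos_INR k); lra].
Qed.

Lemma asin_derive (r : R) : -1 < r < 1 -> is_derive asin r (1 / sqrt (1 - r²))%R.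
Proof.
  intros Hr; apply is_derive_Reals.
  apply (derive_pt_eq_1 _ _ _ (derivable_pt_asin r Hr)), derive_pt_asin.
Qed.

Lemma PSeries_partial_le (a : nat -> R) (x : R) (N : nat) :
  (forall k, 0 <= a k <= 1) -> 0 <= x < 1 ->
  sum_n (fun k => a k * x ^ k)%R N <= PSeries a x.
Proof.
  intros Ha Hx; apply sum_n_le_Series.
  - intros k; apply Rmult_le_pos; [apply Ha | apply pow_le; lra].
  - apply (ex_series_le (V := R_CompleteNormedModule) _ (fun k => x ^ k)%R).
    + intros k; unfold norm; simpl; unfold abs; simpl.
      assert (0 <= x ^ k) by (apply pow_le; lra).
      pose proof (Ha k); rewrite Rabs_pos_eq; nra.
    + apply ex_series_geom; rewrite Rabs_pos_eq; lra.
Qed.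

Lemma Re_Beta_1 (r : R) : Re (Beta (1 * 1) r) = PSeries cbin (r ^ 2).
Proof.
  unfold Beta; rewrite CPSeries_PSeries; simpl; apply PSeries_ext; intros k.
  unfold bcoef; rewrite Cmult_1_l, Cpow_1_l; simpl; ring.
Qed.

Lemma Im_Beta_1 (r : R) : Im (Beta (1 * 1) r) = 0%R.
Proof.
  unfold Beta; rewrite CPSeries_PSeries; simpl.
  rewrite (PSeries_ext _ (fun _ => 0%R)); [apply PSeries_const_0|]; intros k.
  unfold bcoef; rewrite Cmult_1_l, Cpow_1_l; simpl; ring.
Qed.

Lemma Re_Arc_1 (r : R) : Re (Arc 1 r) = (r * PSeries asin_coef (r ^ 2))%R.
Proof.
  unfold Arc, Phi; rewrite CPSeries_PSeries.
  replace ((RtoC r * 1) ^ 1) with (RtoC r) by ring.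
  simpl; rewrite (PSeries_ext _ asin_coef); [ring|]; intros k.
  unfold coef, asin_coef; rewrite Cmult_1_l, Cpow_1_l, Rplus_0_r; simpl; ring.
Qed.

(** For [w = 1] the derivative [Beta] is real and equals [1 / sqrt (1 - r ^ 2)], the derivative of
    [asin]. *)
Lemma Re_Arc_1_asin (r : R) : 0 <= r < 1 -> Re (Arc 1 r) = asin r.
Proof.
  intros Hr; assert (H1 : Cmod 1 <= 1) by (rewrite Cmod_1; lra).
  assert (E : (Re (Arc 1 r) - asin r = Re (Arc 1 0) - asin 0)%R).
  { apply (is_derive_0_const (fun s => Re (Arc 1 s) - asin s)%R r 1); trivial.
    intros s Hs; pose proof (Beta_sqr (1 * 1) s (Cmod_sqr_le1 1 H1) Hs) as E.
    eapply is_derive_val.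
    - apply is_derive_Rminus; [apply (Arc_derive 1 s H1 Hs) | apply asin_derive; lra].
    - apply (f_equal Re) in E.
      (* The partial sum of index 0 is already 1. This positivity selects the right sign of the root
         in [Beta_sqr]. *)
      assert (HB : 1 <= Re (Beta (1 * 1) s)).
      { rewrite Re_Beta_1; eapply Rle_trans; [|apply (PSeries_partial_le cbin (s ^ 2) 0)].
        - rewrite sum_O, cbin_0; simpl; lra.
        - intros k; pose proof (cbin_pos k); pose proof (cbin_le1 k); lra.
        - nra. }
      rewrite (Cmult_1_l (Beta (1 * 1) s)).
      pose proof (Im_Beta_1 s) as HI.
      set (B := Beta (1 * 1) s) in *; clearbody B; destruct B as [b c].
      simpl in HI, HB; subst c.
      assert (E' : (b * b * (1 - s²) = 1)%R).
      { rewrite <- RtoC_pow, !Cmult_1_r, <- RtoC_minus in E.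
        unfold Rsqr; simpl in E; lra. }
      simpl Re.
      assert (Hp : 0 < 1 - s²) by (unfold Rsqr; nra).
      pose proof (sqrt_lt_R0 _ Hp) as Hq; pose proof (sqrt_sqrt _ (Rlt_le _ _ Hp)) as Hs2.
      set (t := sqrt (1 - s²)) in *.
      assert (b * t = 1)%R.
      { rewrite <- Hs2 in E'; assert (H : ((b * t - 1) * (b * t + 1) = 0)%R) by lra.
        assert (0 < b * t + 1) by nra.
        apply Rmult_integral in H; lra. }
      field_simplify_eq; lra. }
  rewrite asin_0 in E; unfold Arc in E at 2; rewrite Phi_0 in E.
  change (Re 0) with 0%R in E; lra.
Qed.

(** With [N] fixed, the truncated series at [r < 1] is at most [asin r], hence at most [PI / 2];
    then [r] tends to 1. *)
Lemma asin_coef_sum (N : nat) : sum_n asin_coef N <= PI / 2.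
Proof.
  assert (Hc : forall k, 0 <= asin_coef k <= 1).
  { intros k; split; [left; apply asin_coef_pos|].
    unfold asin_coef; pose proof (cbin_le1 k); pose proof (pos_INR k).
    apply Rmult_le_reg_r with (2 * INR k + 1)%R; [lra|].
    unfold Rdiv; rewrite Rmult_assoc, Rinv_l; lra. }
  rewrite <- (Rmult_1_l (sum_n asin_coef N)).
  apply (is_lim_seq_le (fun j => ray j * sum_n (fun k => asin_coef k * (ray j ^ 2) ^ k)%R N)%R
           (fun _ => PI / 2)%R (1 * sum_n asin_coef N)%R (PI / 2)%R).
  - intros j; pose proof (ray_bound j) as Hr.
    apply Rle_trans with (asin (ray j)); [|apply asin_bound].
    rewrite <- Re_Arc_1_asin, Re_Arc_1 by trivial.
    apply Rmult_le_compat_l; [lra|]; apply PSeries_partial_le; trivial; nra.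
  - apply is_lim_seq_mult'; [apply ray_lim | apply psum_lim, ray_sqr_lim].
  - apply is_lim_seq_const.
Qed.

Lemma asin_coef_ex : ex_series asin_coef.
Proof.
  destruct (ex_finite_lim_seq_incr (sum_n asin_coef) (PI / 2)) as [l Hl].
  - intros N; rewrite sum_Sn; unfold plus; simpl; pose proof (asin_coef_pos (S N)); lra.
  - apply asin_coef_sum.
  - now exists l.
Qed.

Lemma asin_coef_Series : Series asin_coef <= PI / 2.
Proof.
  apply (is_lim_seq_le (sum_n asin_coef) (fun _ => PI / 2)%R
           (Series asin_coef) (PI / 2)%R).
  - apply asin_coef_sum.
  - apply (Series_correct _ asin_coef_ex).
  - apply is_lim_seq_const.
Qed.

(** * The principal arcsine and the primitives on the closed disc *)

Lemma coef_series (z : C) (m : nat) : Cmod z <= 1 ->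
  Cis_series (coef z m) (CSeries (coef z m)).
Proof.
  intros Hz; apply CSeries_correct with asin_coef; [|exact asin_coef_ex].
  intros k; now apply Cmod_coef.
Qed.

Lemma ray_mult_lim (w : C) : clim (fun j => RtoC (ray j) * w) w.
Proof.
  assert (H : clim (fun j => RtoC (ray j) * w) (RtoC 1 * w))
    by (apply clim_mult; [apply clim_real, ray_lim | apply clim_const]).
  now rewrite Cmult_1_l in H.
Qed.

Lemma coef_series_lim (w : C) (m : nat) : Cmod w <= 1 ->
  clim (fun j => Phi w m (ray j)) (w ^ S m * CSeries (coef (w * w) m)).
Proof.
  intros Hw; unfold Phi; apply clim_mult.
  - apply clim_pow, ray_mult_lim.
  - apply CPSeries_clim with asin_coef; [|exact asin_coef_ex| |exact ray_sqr_lim].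
    + intros k; apply Cmod_coef, Cmod_sqr_le1, Hw.
    + intros j; pose proof (ray_bound j); nra.
Qed.

(** The sum [t] satisfies [Csin t = w] as a limit of [Arc_sin], and its modulus is at most [PI / 2],
    so [Carcsin_Csin] applies. *)
Lemma Carcsin_series (w : C) : Cmod w <= 1 ->
  Carcsin w = w * CSeries (coef (w * w) 0).
Proof.
  intros Hw; set (t := w * CSeries (coef (w * w) 0)).
  assert (Hlim : clim (fun j => Arc w (ray j)) t).
  { unfold t; replace (w * _) with (w ^ 1 * CSeries (coef (w * w) 0)) by ring.
    now apply coef_series_lim. }
  assert (Hsin : Csin t = w).
  { apply (clim_unique (fun j => Csin (Arc w (ray j)))).
    - pose proof (proj2 (hol_Csin 1) _ _ Hlim) as L; cbv beta in L; rewrite Cmult_1_l in L.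
      apply clim_ext with (2 := L); intros j; now rewrite Cmult_1_l.
    - apply clim_ext with (fun j => RtoC (ray j) * w).
      { intros j; symmetry; apply Arc_sin; [trivial | apply ray_bound]. }
      apply ray_mult_lim. }
  rewrite <- Hsin; apply Carcsin_Csin.
  unfold t; rewrite Cmod_mult.
  assert (Cmod (CSeries (coef (w * w) 0)) <= Series asin_coef).
  { apply Cis_series_Cmod_le with (coef (w * w) 0).
    - apply coef_series, Cmod_sqr_le1, Hw.
    - intros k; apply Cmod_coef, Cmod_sqr_le1, Hw.
    - exact asin_coef_ex. }
  pose proof asin_coef_Series; pose proof (Cmod_ge_0 w).
  pose proof (Cmod_ge_0 (CSeries (coef (w * w) 0))); nra.
Qed.

(** The limit of [Phi_eq] as [r] tends to 1, by the continuity contained in [hol]. *)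
Lemma integral_sin_pow (w : C) (m : nat) (H : C -> C) :
  Cmod w <= 1 -> H 0 = 0 -> hol H (fun t => Csin t ^ m) ->
  w ^ S m * CSeries (coef (w * w) m) = H (Carcsin w).
Proof.
  intros Hw H0 HH; rewrite Carcsin_series by trivial.
  apply (clim_unique (fun j => Phi w m (ray j))); [now apply coef_series_lim|].
  apply clim_ext with (fun j => H (Arc w (ray j))).
  { intros j; symmetry; apply Phi_eq; trivial; apply ray_bound. }
  apply HH; replace (w * _) with (w ^ 1 * CSeries (coef (w * w) 0)) by ring.
  now apply coef_series_lim.
Qed.

(** * Values of the series *)

(** Every term from index 1 on contains a factor [z]; what remains is majorised by the arcsine
    coefficients. The bound yields the limit at 0. *)
Lemma coef_tail (z : C) (m : nat) : Cmod z <= 1 ->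
  Cis_series (fun k => coef z m (S k)) (CSeries (coef z m) - coef z m 0) /\
  Cmod (CSeries (coef z m) - coef z m 0) <= Cmod z * (PI / 2).
Proof.
  intros Hz.
  assert (H : Cis_series (fun k => coef z m (S k)) (CSeries (coef z m) - coef z m 0)).
  { apply Cis_series_incr_1.
    replace (_ - _ + _) with (CSeries (coef z m)) by ring; now apply coef_series. }
  split; [exact H|].
  assert (Hex : ex_series (fun k => asin_coef (S k)))
    by (apply (proj1 (ex_series_incr_1 (V := R_NormedModule) asin_coef)), asin_coef_ex).
  eapply Rle_trans.
  - eapply Cis_series_Cmod_le with (a := fun k => (Cmod z * asin_coef (S k))%R); [exact H | |].
    + intros k; cbv beta.
      replace (coef z m (S k)) with
        (z * (RtoC (cbin (S k) / (2 * INR (S k) + INR m + 1)) * z ^ k))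
        by (unfold coef; rewrite Cpow_S; ring).
      rewrite Cmod_mult; apply Rmult_le_compat_l; [apply Cmod_ge_0|].
      pose proof (cbin_pos (S k)); pose proof (pos_INR (S k)); pose proof (pos_INR m).
      rewrite Cmod_RtoC_mult, Rabs_pos_eq
        by (apply Rmult_le_pos; [lra | left; apply Rinv_0_lt_compat; lra]).
      rewrite <- Rmult_1_r; apply Rmult_le_compat.
      * apply Rmult_le_pos; [lra | left; apply Rinv_0_lt_compat; lra].
      * apply Cmod_ge_0.
      * apply Rmult_le_compat_l; [lra|]; apply Rinv_le_contravar; lra.
      * now apply Cmod_pow_le1.
    + apply (ex_series_scal (V := R_NormedModule)), Hex.
  - rewrite Series_scal_l; apply Rmult_le_compat_l; [apply Cmod_ge_0|].
    pose proof (Series_incr_1 _ asin_coef_ex) as E; pose proof (asin_coef_pos 0).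
    pose proof asin_coef_Series; lra.
Qed.

(** The common frame of both formulas. The series lacks its term of index 0, so its value at [z = 0]
    is 0, and [coef_tail] shows that [f] tends to 0 there. *)
Lemma value_of_coef_series (c : C) (m : nat) (f : C -> C) (a : nat -> C) (z : C) :
  Cmod z <= 1 ->
  (forall w : C, w <> 0 -> Cmod w <= 1 ->
     f w = c * (CSeries (coef w m) - coef w m 0)) ->
  (forall k, a k = c * coef z m k) ->
  exists s, is_series_from1 a s /\ is_value_lim0 f z s.
Proof.
  intros Hz Hf Ha; exists (c * (CSeries (coef z m) - coef z m 0)).
  destruct (coef_tail z m Hz) as [Hs Hb]; split; [|split].
  - apply Cis_series_ext with (fun k => c * coef z m (S k));
      [intros; now rewrite Ha | now apply Cis_series_scal].
  - intros H; symmetry; now apply Hf.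
  - intros ->; rewrite Cmod_0, Rmult_0_l in Hb.
    replace (CSeries (coef 0 m) - coef 0 m 0) with (RtoC 0)
      by (symmetry; apply Cmod_eq_0;
          pose proof (Cmod_ge_0 (CSeries (coef 0 m) - coef 0 m 0)); lra).
    rewrite Cmult_0_r.
    apply filterlim_locally; intros eps.
    pose proof (cond_pos eps) as He; pose proof (Cmod_ge_0 c) as Hc; pose proof PI_RGT_0.
    (* The summand 1 keeps [M] positive even if [c = 0]. *)
    set (M := (Cmod c * (PI / 2) + 1)%R).
    assert (HM : 0 < M) by (unfold M; nra).
    (* Balls of [C] are squares, so [Cmod w < 2 d]. The bound [1 / 2] keeps [w] in the unit disc,
       the other one makes [f w] smaller than [eps]. *)
    assert (Hd : 0 < Rmin (1 / 2) (eps / (2 * M)))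
      by (apply Rmin_glb_lt; [lra | apply Rdiv_lt_0_compat; lra]).
    exists (mkposreal _ Hd); intros w [B1 B2] Hw; simpl in B1, B2.
    set (d := Rmin (1 / 2) (eps / (2 * M))) in *.
    assert (D1 : d <= 1 / 2) by apply Rmin_l.
    assert (D2 : d * (2 * M) <= eps).
    { apply Rle_trans with (eps / (2 * M) * (2 * M))%R.
      - apply Rmult_le_compat_r; [lra | apply Rmin_r].
      - right; field; lra. }
    assert (Hwd : Cmod w < 2 * d).
    { change (Rabs (Re w - 0) < d) in B1; change (Rabs (Im w - 0) < d) in B2.
      apply Rabs_def2 in B1; apply Rabs_def2 in B2.
      pose proof (Cmod_sqr w); pose proof (Cmod_ge_0 w); nra. }
    assert (Hfw : Cmod (f w) < eps).
    { rewrite Hf, Cmod_mult by (trivial; lra).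
      destruct (coef_tail w m) as [_ Hwb]; [lra|].
      pose proof (Cmod_ge_0 w).
      apply Rle_lt_trans with (Cmod c * (Cmod w * (PI / 2)))%R;
        [now apply Rmult_le_compat_l|].
      unfold M in D2; nra. }
    split.
    + change (Rabs (Re (f w) - 0) < eps); rewrite Rminus_0_r.
      eapply Rle_lt_trans; [apply Re_le_Cmod | exact Hfw].
    + change (Rabs (Im (f w) - 0) < eps); rewrite Rminus_0_r.
      eapply Rle_lt_trans; [apply Im_le_Cmod | exact Hfw].
Qed.

Lemma Cmod_Csqrt_le1 (w : C) : Cmod w <= 1 -> Cmod (Csqrt w) <= 1.
Proof.
  intros Hw; rewrite <- (Csqrt_sqr w), Cmod_mult in Hw.
  pose proof (Cmod_ge_0 (Csqrt w)); nra.
Qed.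

Lemma Csqrt_nz (w : C) : w <> 0 -> Csqrt w <> 0.
Proof. intros Hw E; apply Hw; rewrite <- (Csqrt_sqr w), E; ring. Qed.

(** Both sides are the exponential of the same multiple of [Clog w]. *)
Lemma Cpower_half (w : C) (n : nat) : w <> 0 ->
  Cpower w (RtoC (INR n + 1 / 2)) = Csqrt w ^ S (2 * n).
Proof.
  intros Hw; unfold Csqrt, Cpower; destruct (Ceq_dec w 0) as [E|_]; [contradiction|].
  rewrite Cexp_pow, Cmult_assoc, <- RtoC_mult; do 3 f_equal.
  rewrite S_INR, mult_INR; simpl; field.
Qed.

Lemma Csum_eq0 (f : nat -> C) (m : nat) : (forall k, f k = 0) -> Csum f m = 0.
Proof.
  intros H; induction m as [|m IH]; rewrite ?Csum_0, ?Csum_S, ?IH, H; ring.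
Qed.

Lemma Heven_0 (n : nat) : Heven n 0 = 0.
Proof.
  unfold Heven; rewrite Csum_eq0; [ring|]; intros k.
  destruct (Nat.eqb k n); [reflexivity|].
  rewrite Cmult_0_r, Csin_0; unfold Cdiv; ring.
Qed.

Lemma Ccos_0 : Ccos 0 = 1.
Proof.
  unfold Ccos; rewrite Cmult_0_r; replace (- 0) with (RtoC 0) by ring.
  rewrite Cexp_0; field.
Qed.

Lemma Hodd_0 (n : nat) : Hodd n 0 = 0.
Proof.
  unfold Hodd; apply Csum_eq0; intros k.
  rewrite Cmult_0_r, Ccos_0; unfold Cdiv; ring.
Qed.

Lemma coef_0 (w : C) (m : nat) : coef w m 0 = RtoC (1 / (INR m + 1)).
Proof.
  unfold coef; rewrite cbin_0; simpl INR; simpl Cpow; rewrite Cmult_1_r.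
  do 2 f_equal; ring.
Qed.

Lemma div4_pow (b : R) (z : C) (k : nat) :
  RtoC b * (z / RtoC 4) ^ k = RtoC (b / 4 ^ k) * z ^ k.
Proof.
  assert (H : (4 ^ k)%R <> 0%R) by (apply pow_nonzero; lra).
  unfold Cdiv; rewrite Cpow_mult_l, Cpow_inv, <- RtoC_pow by (apply RtoC_nz; lra).
  rewrite RtoC_div by exact H; field; now apply RtoC_nz.
Qed.

Theorem corollary2 (n : nat) (z : C) (hz : (Cmod z <= 1)%R) :
  (exists s : C,
     is_series_from1
       (fun k : nat =>
          RtoC (binom (2 * k) k * (1 / (2 * INR k + 2 * INR n + 1)))
          * (z / RtoC 4) ^ k)
       s
     /\
     is_value_lim0
       (fun w : C =>
          RtoC 1 / (RtoC 4 ^ n * Cpower w (RtoC (INR n + 1 / 2)))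
          * (RtoC (binom (2 * n) n) * Carcsin (Csqrt w)
             + RtoC (-1) ^ n
               * Csum
                   (fun k : nat =>
                      if Nat.eqb k n then RtoC 0
                      else
                        RtoC (-1) ^ k * RtoC (binom (2 * n) k)
                        * (Csin (RtoC (2 * (INR n - INR k)) * Carcsin (Csqrt w))
                           / RtoC (2 * (INR n - INR k))))
                   (2 * n))
          - RtoC (1 / (1 + 2 * INR n)))
       z s)
  /\
  (exists s : C,
     is_series_from1
       (fun k : nat =>
          RtoC (binom (2 * k) k * (1 / (1 + INR k + INR n)))
          * (z / RtoC 4) ^ k)
       s
     /\
     is_value_lim0
       (fun w : C =>
          RtoC (-1) ^ (1 + n) / (RtoC 4 ^ n * w ^ (1 + n))
          * Csum
              (fun k : nat =>
                 RtoC (-1) ^ k * RtoC (binom (1 + 2 * n) k)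
                 * ((Ccos (RtoC (2 * INR n - 2 * INR k + 1) * Carcsin (Csqrt w))
                     - RtoC 1)
                    / RtoC (2 * INR n - 2 * INR k + 1)))
              (1 + 2 * n)
          - RtoC (1 / (1 + INR n)))
       z s).
Proof.
  assert (H4 : RtoC 4 ^ n <> 0) by (apply Cpow_nz, RtoC_nz; lra).
  pose proof (pos_INR n) as Hn.
  split.
  (* The subtracted [1 / (1 + 2 n)] is the missing term of index 0. *)
  - apply (value_of_coef_series 1 (2 * n)); trivial.
    + intros w Hw0 Hw.
      pose proof (integral_sin_pow (Csqrt w) (2 * n) (fun t => / RtoC 4 ^ n * Heven n t)
                    (Cmod_Csqrt_le1 w Hw)) as E.
      rewrite Csqrt_sqr in E.
      change (RtoC 1 / (RtoC 4 ^ n * Cpower w (RtoC (INR n + 1 / 2)))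
              * Heven n (Carcsin (Csqrt w)) - RtoC (1 / (1 + 2 * INR n)) =
              1 * (CSeries (coef w (2 * n)) - coef w (2 * n) 0)).
      rewrite Cpower_half, coef_0, mult_INR by trivial.
      replace (INR 2 * INR n + 1)%R with (1 + 2 * INR n)%R by (simpl; ring).
      assert (Hu : Csqrt w ^ S (2 * n) <> 0) by now apply Cpow_nz, Csqrt_nz.
      rewrite Cmult_1_l; f_equal.
      transitivity (/ Csqrt w ^ S (2 * n) * (/ RtoC 4 ^ n * Heven n (Carcsin (Csqrt w)))).
      * field; split; trivial.
      * rewrite <- E; [field; trivial | rewrite Heven_0; ring |].
        eapply hol_ext; [reflexivity | | apply hol_scal, Heven_hol].
        intros t; simpl; field; trivial.
    + intros k; rewrite div4_pow, Cmult_1_l; unfold coef, cbin; do 2 f_equal.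
      rewrite mult_INR; simpl (INR 2); pose proof (pos_INR k).
      field; split; [apply pow_nonzero|]; lra.
  (* The factor 2 comes from [1 / (1 + k + n) = 2 / (2 k + (2 n + 1) + 1)]. *)
  - apply (value_of_coef_series (RtoC 2) (S (2 * n))); trivial.
    + intros w Hw0 Hw.
      pose proof (integral_sin_pow (Csqrt w) (S (2 * n))
                    (fun t => RtoC (-1) ^ (1 + n) / (RtoC 2 * RtoC 4 ^ n) * Hodd n t)
                    (Cmod_Csqrt_le1 w Hw)) as E.
      rewrite Csqrt_sqr in E.
      change (RtoC (-1) ^ (1 + n) / (RtoC 4 ^ n * w ^ (1 + n))
              * Hodd n (Carcsin (Csqrt w)) - RtoC (1 / (1 + INR n)) =
              RtoC 2 * (CSeries (coef w (S (2 * n))) - coef w (S (2 * n)) 0)).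
      rewrite coef_0, S_INR, mult_INR.
      replace (RtoC (1 / (1 + INR n))) with (RtoC 2 * RtoC (1 / (INR 2 * INR n + 1 + 1)))
        by (rewrite <- RtoC_mult; f_equal; simpl; field; lra).
      assert (Hu : w ^ (1 + n) <> 0) by now apply Cpow_nz.
      (* The exponent [2 n + 2] is even, so the prefactor is an integer power of [w]. *)
      replace (Csqrt w ^ S (S (2 * n))) with (w ^ (1 + n)) in E.
      2: { rewrite <- (Csqrt_sqr w) at 1; replace (S (S (2 * n))) with (2 * (1 + n))%nat by lia.
           rewrite Cpow_mult_r; f_equal; ring. }
      transitivity (RtoC 2 * (/ w ^ (1 + n) *
        (RtoC (-1) ^ (1 + n) / (RtoC 2 * RtoC 4 ^ n) * Hodd n (Carcsin (Csqrt w))))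
        - RtoC 2 * RtoC (1 / (INR 2 * INR n + 1 + 1))).
      * f_equal; field; split; trivial.
      * rewrite <- E; [field; trivial | rewrite Hodd_0; ring |].
        eapply hol_ext; [reflexivity | | apply hol_scal, Hodd_hol].
        intros t; cbv beta; change (1 + 2 * n)%nat with (S (2 * n)).
        rewrite (Cpow_S _ n : RtoC (-1) ^ (1 + n) = _), RtoC_opp1.
        pose proof (Cpow_opp1_sqr n) as E1; rewrite RtoC_opp1 in E1.
        set (a := (- RtoC 1) ^ n) in *.
        transitivity ((a * a) * Csin t ^ S (2 * n)); [field; trivial | rewrite E1; ring].
    + intros k; rewrite div4_pow; unfold coef, cbin.
      rewrite Cmult_assoc, <- RtoC_mult; do 2 f_equal.
      rewrite S_INR, mult_INR; simpl (INR 2); pose proof (pos_INR k).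
      field; repeat split; try apply pow_nonzero; lra.
Qed.
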